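(* Let $p\in\mathcal P$. There is a constant $C>0$ (independent of $f$) such that for every martingale $f=(f_n)_{n\ge0}\in\mathcal Q_{p(\cdot)}$ (respectively $f\in\mathcal D_{p(\cdot)}$) there exist a sequence $(a^k)_{k\in\mathbb Z}$ of $p$-$A_2$ atoms (respectively $p$-$A_3$ atoms) and a sequence $(\theta_k)_{k\in\mathbb Z}$ of nonnegative numbers such that $$f_n=\sum_{k\in\mathbb Z}\theta_kE_na^k\quad\text{a.e., for all }n\ge0,$$ and $$C^{-1}\Big(\sum_{k\in\mathbb Z}\theta_k^{p^+}\Big)^{1/p^+}\le\|f\|\le C\Big(\sum_{k\in\mathbb Z}\theta_k^{p^-}\Big)^{1/p^-},$$ where $\|f\|$ denotes $\|f\|_{\mathcal Q_{p(\cdot)}}$ (respectively $\|f\|_{\mathcal D_{p(\cdot)}}$). Moreover, if $p^+\le\eta$, where $\eta$ is the Aoki–Rolewicz constant of $L^{p(\cdot)}$, then $\sum_{k=j}^m\theta_ka^k$ converges to $f$ in the quasi-norm of $\mathcal Q_{p(\cdot)}$ (respectively $\mathcal D_{p(\cdot)}$) as $j\to-\infty$, $m\to\infty$.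
   Context: $(\Omega,\Sigma,\mu)$ is a complete probability space with expectation $E$. $\mathcal P$ is the set of measurable $p:\Omega\to(0,\infty)$ with $0<p^-\le p^+<\infty$, where $p^-=\operatorname{ess\,inf}p$ and $p^+=\operatorname{ess\,sup}p$. For $p\in\mathcal P$ and measurable $u$, $\rho_{p(\cdot)}(u)=E(|u|^{p})=\int_\Omega|u(\omega)|^{p(\omega)}d\mu$, and $\|u\|_{p(\cdot)}=\inf\{\gamma>0:\rho_{p(\cdot)}(u/\gamma)\le1\}$ (with $\inf\emptyset=\infty$); $L^{p(\cdot)}$ is the set of $u$ with $\|u\|_{p(\cdot)}<\infty$, a quasi-normed space. Aoki–Rolewicz constant: by the Aoki–Rolewicz theorem there are $\eta\in(0,1]$ and a quasi-norm $\|\cdot\|_*$ on $L^{p(\cdot)}$, equivalent to $\|\cdot\|_{p(\cdot)}$, such that $\|x+y\|_*^\eta\le\|x\|_*^\eta+\|y\|_*^\eta$ for all $x,y$; $\eta$ denotes such an exponent. $(\Sigma_n)_{n\ge0}$ is a nondecreasing sequence of sub-$\sigma$-algebras of $\Sigma$ with $\Sigma=\bigvee_n\Sigma_n$, and $\Sigma_{-1}=\{\Omega,\emptyset\}$. $E_n$ is conditional expectation with respect to $\Sigma_n$. For a martingale $f=(f_n)_{n\ge0}$ adapted to $(\Sigma_n)$, put $f_{-1}=0$, $d_nf=f_n-f_{n-1}$ $(n\ge0)$, $f^*=\sup_{n\ge0}|f_n|$, $S_n(f)=\big(\sum_{i=0}^n|d_if|^2\big)^{1/2}$, $S(f)=\lim_nS_n(f)$.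 An integrable function $a$ is identified with the martingale $(E_na)_{n\ge0}$. $\Lambda$ is the class of non-negative, non-decreasing sequences $\lambda=(\lambda_n)_{n\ge-1}$ adapted to $(\Sigma_n)_{n\ge-1}$, with $\lambda_\infty=\lim_n\lambda_n$. Then $\|f\|_{\mathcal Q_{p(\cdot)}}=\inf\|\lambda_\infty\|_{p(\cdot)}$, the infimum over all $\lambda\in\Lambda$ with $S_n(f)\le\lambda_{n-1}$ for all $n\ge0$, and $\|f\|_{\mathcal D_{p(\cdot)}}=\inf\|\lambda_\infty\|_{p(\cdot)}$, the infimum over all $\lambda\in\Lambda$ with $|f_n|\le\lambda_{n-1}$ for all $n\ge0$; $\mathcal Q_{p(\cdot)}$ and $\mathcal D_{p(\cdot)}$ are the sets of martingales for which the corresponding quantity is finite. A $\Sigma$-measurable (integrable) function $a$ is a $p$-$A_2$ atom (respectively $p$-$A_3$ atom) if there is a stopping time $\tau$ with respect to $(\Sigma_n)_{n\ge-1}$, with values in $\{-1,0,1,\dots\}\cup\{\infty\}$, such that (1) for every $n\ge0$, $E_na=0$ on $\{n\le\tau\}$; and (2) $\|S(a)\|_\infty\le\|\chi_{\{\tau<\infty\}}\|_{p(\cdot)}^{-1}$ (respectively $\|a^*\|_\infty\le\|\chi_{\{\tau<\infty\}}\|_{p(\cdot)}^{-1}$). Convergence means that the quasi-norm of the martingale $\big(f_n-\sum_{k=j}^m\theta_kE_na^k\big)_{n\ge0}$ tends to $0$. *)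

(* Defs.v *)
From HB Require Import structures.
From mathcomp Require Import all_boot all_order all_algebra.
From mathcomp Require Import all_classical all_reals all_analysis.
From mathcomp Require Import ess_sup_inf.

Set Implicit Arguments.
Unset Strict Implicit.
Unset Printing Implicit Defensive.

Import Order.TTheory GRing.Theory Num.Theory.
Import numFieldNormedType.Exports.

Local Open Scope classical_set_scope.
Local Open Scope ring_scope.

Section variable_lebesgue.
Context d (T : measurableType d) (R : realType).
Variable P : probability T R.
Implicit Types p : T -> R.

Definition variable_exponent p : Prop :=
  [/\ measurable_fun setT p, (forall x, 0 < p x),
      (0 < ess_inf P (EFin \o p))%E & (ess_sup P (EFin \o p) < +oo)%E].

Definition exponent_minus p : R := fine (ess_inf P (EFin \o p)).
Definition exponent_plus p : R := fine (ess_sup P (EFin \o p)).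

Definition modular p (u : T -> \bar R) : \bar R :=
  (\int[P]_x (`|u x| `^ p x))%E.

Definition luxnorm p (u : T -> \bar R) : \bar R :=
  ereal_inf [set g%:E | g in
    [set g : R | 0 < g /\ (modular p (fun x => u x * g^-1%:E) <= 1)%E]].

Definition Lp_var p : set (T -> R) :=
  [set u | measurable_fun setT u /\ (luxnorm p (EFin \o u) < +oo)%E].

(* Elements of L^p(.) are identified when they agree almost everywhere, hence
   the first two clauses. *)
Definition quasi_norm_on p (N : (T -> R) -> R) : Prop :=
  [/\ (forall u v, Lp_var p u -> Lp_var p v ->
         {ae P, forall x, u x = v x} -> N u = N v),
      (forall u, Lp_var p u ->
         0 <= N u /\ (N u = 0 <-> {ae P, forall x, u x = 0})),
      (forall (c : R) u, Lp_var p u -> N (fun x => c * u x) = `|c| * N u) &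
      exists2 K : R, 1 <= K & forall u v, Lp_var p u -> Lp_var p v ->
         N (fun x => u x + v x) <= K * (N u + N v)].

Definition equivalent_to_luxnorm p (N : (T -> R) -> R) : Prop :=
  exists c C : R, [/\ 0 < c, 0 < C & forall u, Lp_var p u ->
    (c%:E * luxnorm p (EFin \o u) <= (N u)%:E)%E /\
    ((N u)%:E <= C%:E * luxnorm p (EFin \o u))%E].

Definition aoki_rolewicz_exponent p (eta : R) : Prop :=
  0 < eta <= 1 /\
  exists N : (T -> R) -> R,
    [/\ quasi_norm_on p N, equivalent_to_luxnorm p N &
        forall u v, Lp_var p u -> Lp_var p v ->
          N (fun x => u x + v x) `^ eta <= N u `^ eta + N v `^ eta].

End variable_lebesgue.

Section martingales.
Context d (T : measurableType d) (R : realType).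
Variable P : probability T R.
Implicit Types (f : nat -> T -> R) (G : set (set T)) (Sig : nat -> set (set T)).

Definition filtration Sig : Prop :=
  [/\ (forall n, sigma_algebra setT (Sig n)),
      (forall n, Sig n `<=` measurable),
      (forall m n, (m <= n)%N -> Sig m `<=` Sig n) &
      <<s \bigcup_n Sig n >> = measurable].

(* The filtration indexed by n >= -1, with the trivial sigma-algebra at -1; the
   values at indices below -1 are never used. *)
Definition filtration_ext Sig (k : int) : set (set T) :=
  match k with
  | Posz n => Sig n
  | Negz _ => [set set0; setT]
  end.

Definition measurable_wrt G (g : T -> R) : Prop :=
  measurable_fun setT (g : g_sigma_algebraType G -> R).

Definition is_condexp G (g h : T -> R) : Prop :=
  [/\ measurable_wrt G h, P.-integrable setT (EFin \o h) &
      forall A, G A ->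
        (\int[P]_(x in A) (h x)%:E = \int[P]_(x in A) (g x)%:E)%E].

(* A choice of version of E(g | G), for g integrable; it is determined only up
   to almost everywhere equality, so it must only be used in statements that
   do not depend on the version. *)
Definition condexp G (g : T -> R) : T -> R :=
  xget (cst 0) [set h | is_condexp G g h].

Definition martingale Sig f : Prop :=
  (forall n, P.-integrable setT (EFin \o f n)) /\
  (forall m n, (n <= m)%N -> is_condexp (Sig n) (f m) (f n)).

Definition martingale_of Sig (a : T -> R) : nat -> T -> R :=
  fun n => condexp (Sig n) a.

Definition mdiff f (n : nat) (x : T) : R :=
  if n is m.+1 then f n x - f m x else f 0%N x.

Definition maximal_function f (x : T) : \bar R :=
  ereal_sup (range (fun n => `|f n x|%:E)).

Definition square_function_upto f (n : nat) (x : T) : R :=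
  Num.sqrt (\sum_(i < n.+1) `|mdiff f i x| ^+ 2).

Definition square_function f (x : T) : \bar R :=
  limn (fun n => (square_function_upto f n x)%:E).

(* The class Lambda: only the indices k >= -1 are constrained. *)
Definition Lambda Sig : set (int -> T -> R) :=
  [set lam | forall k : int, -1 <= k ->
    [/\ measurable_wrt (filtration_ext Sig k) (lam k),
        (forall x, 0 <= lam k x) &
        (forall x, lam k x <= lam (k + 1) x)]].

Definition lambda_oo (lam : int -> T -> R) (x : T) : \bar R :=
  limn (fun n : nat => (lam n%:Z x)%:E).

(* The infimum over lambda in Lambda such that g_n <= lambda_(n-1) almost
   everywhere, for all n >= 0. *)
Definition predictable_norm Sig (p : T -> R) (g : nat -> T -> R) : \bar R :=
  ereal_inf [set luxnorm P p (lambda_oo lam) | lam in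
    [set lam | Lambda Sig lam /\
       forall n : nat, {ae P, forall x, g n x <= lam (n%:Z - 1) x}]].

Definition Qnorm Sig (p : T -> R) f : \bar R :=
  predictable_norm Sig p (square_function_upto f).

Definition Dnorm Sig (p : T -> R) f : \bar R :=
  predictable_norm Sig p (fun n x => `|f n x|).

Definition Qspace Sig (p : T -> R) : set (nat -> T -> R) :=
  [set f | martingale Sig f /\ (Qnorm Sig p f < +oo)%E].

Definition Dspace Sig (p : T -> R) : set (nat -> T -> R) :=
  [set f | martingale Sig f /\ (Dnorm Sig p f < +oo)%E].

(* Stopping times have values in {-1, 0, 1, ...} and +oo. *)
Definition stopping_time Sig (tau : T -> \bar int) : Prop :=
  (forall x, ((-1)%:E <= tau x)%E) /\
  (forall k : int, -1 <= k ->
     filtration_ext Sig k [set x | (tau x <= k%:E)%E]).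

(* In \bar R the inverse of 0 is +oo, so the size condition is void when
   tau = +oo almost everywhere. *)
Definition atom_for (F : (nat -> T -> R) -> T -> \bar R)
    Sig (p : T -> R) (a : T -> R) : Prop :=
  P.-integrable setT (EFin \o a) /\
  exists tau : T -> \bar int,
    [/\ stopping_time Sig tau,
        (forall n : nat,
           {ae P, forall x, (n%:Z%:E <= tau x)%E -> condexp (Sig n) a x = 0}) &
        ('N[P]_+oo[F (martingale_of Sig a)] <=
         (luxnorm P p (EFin \o \1_[set x | (tau x < +oo)%E]))^-1)%E].

Definition A2_atom := atom_for square_function.
Definition A3_atom := atom_for maximal_function.

End martingales.

(* The sum of u k over the integers -j <= k <= m, where jm = (j, m). *)
Definition zpsum (V : nmodType) (u : int -> V) (jm : nat * nat) : V :=
  \sum_(i < (jm.1 + jm.2).+1) u (i%:Z - jm.1%:Z).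

(* Main.v *)
(** Choose a controlling sequence [lambda] of [f] whose limit [g] has norm at most
    twice the norm of [f], and let [tau_k] be the first time [lambda] exceeds
    [2^k], so that [{tau_k < oo} = {g > 2^k}]. The stopped martingales satisfy
    [f^(tau_k) -> f] as [k -> oo] and [f^(tau_k) -> 0] as [k -> -oo], whence
    [f = sum_k (f^(tau_(k+1)) - f^(tau_k))]. Each increment is controlled by
    [3 * 2^k] and bounded in L^2, so it is closed by an integrable function,
    which is [theta_k] times an atom for [theta_k = 3 * 2^k * ||chi_{g > 2^k}||].
    As [g^p] is comparable pointwise with [sum_k 2^(kp) chi_{g > 2^k}] and with
    [sup_k 2^(kp) chi_{g > 2^k}], comparing modulars and norms of the indicators
    gives both bounds on the coefficients. The remainder of a partial sum is
    controlled by the large values of [lambda] and its small truncations, whose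
    limits vanish in norm by dominated convergence because [p^+ < oo]. *)

Require Import Defs.
From HB Require Import structures.
From mathcomp Require Import all_boot all_order all_algebra.
From mathcomp Require Import all_classical all_reals all_analysis.
From mathcomp Require Import ess_sup_inf.
From mathcomp Require Import measurable_realfun ring lra zify.

Set Implicit Arguments.
Unset Strict Implicit.
Unset Printing Implicit Defensive.

Import Order.TTheory GRing.Theory Num.Theory.
Import numFieldNormedType.Exports.

Local Open Scope classical_set_scope.
Local Open Scope ring_scope.

(** * Stopped sequences *)

Section stopped_sequences.
Context (R : realType).
Implicit Types (u L e : nat -> R) (c : R).

(** The control is predictable: [L i] bounds the functional of the path at index [i] but is known
    one step earlier. Stopping according to [L i <= c] therefore keeps the martingale property and
    never overshoots [c]. A bounded square function does not bound the path uniformly in [n], so the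
    increments of the decomposition cannot be closed as bounded martingales in both cases; but the
    second moments of the path and of its square function agree by orthogonality, and L^2 is where
    the two cases meet. The two exponents appear because the modular is not homogeneous: a modular
    [I <= 1] at scale [s] only gives a norm at most [s * I^(1/p^+)], and a norm [b] below the scale
    [s] only gives a modular at most [(b/s)^(p^-)]. Summed over the levels, the first yields the
    lower bound on the quasi-norm and the second the upper bound. Quasi-norm 0 needs its own
    argument, since a factor 2 leaves no room there: the zero sequence must be shown to control such
    a martingale. *)

Definition seq_diff u (i : nat) : R := if i is m.+1 then u i - u m else u 0%N.

(** On a path [f^~ x] this is convertible to [square_function_upto f n x], so that [Qnorm], like
    [Dnorm] with [abs_at], is an instance of [phi_norm] by conversion. *)
Definition sq_upto u (n : nat) : R :=
  Num.sqrt (\sum_(i < n.+1) `|seq_diff u i| ^+ 2).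

Definition abs_at u (n : nat) : R := `|u n|.

(* With [L i = lambda_(i-1)] and [tau] the first index where [lambda] exceeds
   [c], [L i <= c] means [i <= tau]. *)
Definition stopped_sum L c e (n : nat) : R :=
  \sum_(i < n.+1) (if L i <= c then e i else 0).

Definition stopped L c u := stopped_sum L c (seq_diff u).

(** For [c = 2^(-j)] and [c' = 2^(m+1)] this is what the partial sum from [-j] to [m] of the
    decomposition misses. *)
Definition rest L c c' u n : R := u n - stopped L c' u n + stopped L c u n.

Lemma seq_diff_sum e n : seq_diff (fun n => \sum_(i < n.+1) e i) n = e n.
Proof.
case: n => [|n] /=; first by rewrite big_ord1.
by rewrite big_ord_recr /= addrAC subrr add0r.
Qed.

Lemma sum_seq_diff u n : \sum_(i < n.+1) seq_diff u i = u n.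
Proof.
elim: n => [|n IH]; first by rewrite big_ord1.
by rewrite big_ord_recr /= IH addrC subrK.
Qed.

Lemma seq_diffB u v n : seq_diff (fun n => u n - v n) n = seq_diff u n - seq_diff v n.
Proof. by case: n => [//|n] /=; ring. Qed.

Lemma seq_diffD u v n : seq_diff (fun n => u n + v n) n = seq_diff u n + seq_diff v n.
Proof. by case: n => [//|n] /=; ring. Qed.

Lemma seq_diffZ r u n : seq_diff (fun n => r * u n) n = r * seq_diff u n.
Proof. by case: n => [//|n] /=; ring. Qed.

Lemma seq_diff_stopped L c u n :
  seq_diff (stopped L c u) n = if L n <= c then seq_diff u n else 0.
Proof. exact: (seq_diff_sum (fun i => if L i <= c then seq_diff u i else 0)). Qed.

Section monotone.
Variable L : nat -> R.
Hypotheses (L0 : forall n, 0 <= L n) (L_nd : forall n, L n <= L n.+1).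

Let L_homo m n : (m <= n)%N -> L m <= L n.
Proof. by move: m n; apply/nondecreasing_seqP. Qed.

Lemma stopped_sum_id c e n : L n <= c ->
  stopped_sum L c e n = \sum_(i < n.+1) e i.
Proof.
move=> Lc; apply: eq_bigr => i _; rewrite ifT//.
by apply: le_trans Lc; apply: L_homo; rewrite -ltnS.
Qed.

(* Since [L] is nondecreasing, the retained indices form an initial segment. *)
Lemma stopped_sumP c e n : stopped_sum L c e n = 0 \/
  exists m, [/\ (m <= n)%N, L m <= c & stopped_sum L c e n = \sum_(i < m.+1) e i].
Proof.
elim: n => [|n IH].
  rewrite /stopped_sum big_ord1; case: ifPn => h; last by left.
  by right; exists 0%N; rewrite big_ord1.
have [Lc|Lc] := leP (L n.+1) c.
  by right; exists n.+1; rewrite stopped_sum_id.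
have -> : stopped_sum L c e n.+1 = stopped_sum L c e n.
  by rewrite {1}/stopped_sum big_ord_recr /= leNgt Lc /= addr0.
case: IH => [->|[m [mn Lm ->]]]; first by left.
by right; exists m; split => //; exact: leqW.
Qed.

Lemma stopped_id c u n : L n <= c -> stopped L c u n = u n.
Proof. by move=> Lc; rewrite /stopped stopped_sum_id// sum_seq_diff. Qed.

(** Unless nothing is retained, the stopped value is [u m] for the last retained index [m], and
    [L m <= c] already bounds [u m] itself: no overshoot. *)
Lemma abs_stopped_le c u n : 0 <= c ->
  (forall i, (i <= n)%N -> `|u i| <= L i) ->
  `|stopped L c u n| <= Num.min (L n) c.
Proof.
move=> c0 uL; rewrite /stopped.
case: (stopped_sumP c (seq_diff u) n) => [->|[m [mn Lm ->]]].
  by rewrite normr0 le_min L0.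
rewrite sum_seq_diff le_min (le_trans (uL _ mn)) ?L_homo//=.
by rewrite (le_trans (uL _ mn)).
Qed.

(** The part stopped at [c] gives the minimum. The part after [c'] is zero while [L n <= c'], and
    otherwise a difference of two values each at most [L n]. *)
Lemma abs_rest_le c c' u n : 0 <= c -> c <= c' ->
  (forall i, (i <= n)%N -> `|u i| <= L i) ->
  `|rest L c c' u n| <= Num.min (L n) c + (if c' < L n then 2 * L n else 0).
Proof.
move=> c0 cc' uL; rewrite /rest addrC.
apply: le_trans (ler_normD _ _) _; apply: lerD; first exact: abs_stopped_le.
case: ifPn => [h|]; last first.
  by rewrite -leNgt => h; rewrite stopped_id// subrr normr0.
apply: le_trans (ler_normB _ _) _.
have := abs_stopped_le (le_trans c0 cc') uL.
rewrite le_min => /andP[h1 _]; have := uL n (leqnn _); lra.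
Qed.

(** The 3 is [2 + 1]: the values stopped at [2 * c] and at [c] are bounded separately. The factor
    [r] will normalise an atom. *)
Lemma abs_jump_le c c' r u n : 0 <= c -> c' = 2 * c -> 0 <= r ->
  (forall i, (i <= n)%N -> `|u i| <= L i) ->
  `|r * (stopped L c' u n - stopped L c u n)| <= r * (3 * c).
Proof.
move=> c0 -> r0 uL; rewrite normrM (ger0_norm r0) ler_wpM2l//.
apply: le_trans (ler_normB _ _) _.
have := abs_stopped_le c0 uL.
have := @abs_stopped_le (2 * c) u n ltac:(lra) uL.
rewrite !le_min => /andP[_ h1] /andP[_ h2]; lra.
Qed.

Lemma sq_upto_le u n c : 0 <= c ->
  (sq_upto u n <= c) = (\sum_(i < n.+1) `|seq_diff u i| ^+ 2 <= c ^+ 2).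
Proof.
move=> c0; rewrite -(ler_sqrt _ (sqr_ge0 c)) sqrtr_sqr ger0_norm//.
Qed.

Lemma stopped_sum_sq_le c u n : 0 <= c ->
  (forall i, (i <= n)%N -> sq_upto u i <= L i) ->
  stopped_sum L c (fun i => `|seq_diff u i| ^+ 2) n <= (Num.min (L n) c) ^+ 2.
Proof.
move=> c0 uL.
have m0 : 0 <= Num.min (L n) c by rewrite le_min L0.
case: (stopped_sumP c (fun i => `|seq_diff u i| ^+ 2) n) => [->|[m [mn Lm ->]]].
  exact: sqr_ge0.
rewrite -sq_upto_le// le_min (le_trans (uL _ mn)) ?L_homo//=.
by rewrite (le_trans (uL _ mn)).
Qed.

(** The two pieces have their increments at disjoint indices, [L i <= c] and [c' < L i], so the
    squares add with no cross term; then [a^2 + b^2 <= (a + b)^2] for nonnegative [a] and [b]. *)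
Lemma sq_rest_le c c' u n : 0 <= c -> c <= c' ->
  (forall i, (i <= n)%N -> sq_upto u i <= L i) ->
  sq_upto (rest L c c' u) n <=
    Num.min (L n) c + (if c' < L n then 2 * L n else 0).
Proof.
move=> c0 cc' uL.
have m0 : 0 <= Num.min (L n) c by rewrite le_min L0.
have Ln := L0 n.
have b0 : 0 <= (if c' < L n then 2 * L n else 0) by case: ifP => // _; lra.
rewrite sq_upto_le ?addr_ge0//.
have -> : \sum_(i < n.+1) `|seq_diff (rest L c c' u) i| ^+ 2 =
  stopped_sum L c (fun i => `|seq_diff u i| ^+ 2) n +
  \sum_(i < n.+1) (if c' < L i then `|seq_diff u i| ^+ 2 else 0).
  rewrite /stopped_sum -big_split; apply: eq_bigr => i _ /=.
  rewrite /rest seq_diffD seq_diffB !seq_diff_stopped.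
  have [h|h] := leP (L i) c; have [h'|h'] := leP (L i) c'.
  - by rewrite subrr add0r addr0.
  - by move: (lt_le_trans h' h); rewrite ltNge cc'.
  - by rewrite subrr !addr0 normr0 expr0n.
  - by rewrite subr0 addr0 add0r.
have h1 := stopped_sum_sq_le c0 uL.
have h2 : \sum_(i < n.+1) (if c' < L i then `|seq_diff u i| ^+ 2 else 0) <=
    (if c' < L n then 2 * L n else 0) ^+ 2.
  case: ifPn => [h|].
    apply: (@le_trans _ _ (L n ^+ 2)); last by nra.
    apply: le_trans (_ : \sum_(i < n.+1) `|seq_diff u i| ^+ 2 <= _).
      by apply: ler_sum => i _; case: ifP => // _; exact: sqr_ge0.
    by rewrite -sq_upto_le//; exact: uL.
  rewrite -leNgt => h; rewrite big1 ?expr0n// => i _; rewrite ltNge.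
  by rewrite (le_trans (L_homo _) h) //; rewrite -ltnS.
nra.
Qed.

(** Only increments with [c < L i <= 2 * c] survive, among those kept at level [2 * c]. This gives
    [r * (2 * c)]; the 3 matches [abs_jump_le]. *)
Lemma sq_jump_le c c' r u n : 0 <= c -> c' = 2 * c -> 0 <= r ->
  (forall i, (i <= n)%N -> sq_upto u i <= L i) ->
  sq_upto (fun n => r * (stopped L c' u n - stopped L c u n)) n <= r * (3 * c).
Proof.
move=> c0 -> r0 uL; rewrite sq_upto_le; last by apply: mulr_ge0 => //; lra.
apply: (@le_trans _ _ (r ^+ 2 * stopped_sum L (2 * c) (fun i => `|seq_diff u i| ^+ 2) n)).
  rewrite /stopped_sum mulr_sumr; apply: ler_sum => i _.
  rewrite seq_diffZ seq_diffB !seq_diff_stopped normrM exprMn (ger0_norm r0).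
  apply: ler_wpM2l; first exact: sqr_ge0.
  have [h|h] := leP (L i) (2 * c); have [h'|h'] := leP (L i) c.
  - by rewrite subrr normr0 expr0n sqr_ge0.
  - by rewrite subr0.
  - by exfalso; lra.
  - by rewrite subrr normr0 expr0n.
rewrite exprMn ler_wpM2l ?sqr_ge0//.
have := @stopped_sum_sq_le (2 * c) u n ltac:(lra) uL.
move=> /le_trans; apply.
have : Num.min (L n) (2 * c) <= 2 * c by rewrite ge_min lexx orbT.
have : 0 <= Num.min (L n) (2 * c) by rewrite le_min L0; lra.
by move: (Num.min _ _) => m; nra.
Qed.

End monotone.

Lemma norm_seq_diff_sq_upto u i n : (i <= n)%N -> `|seq_diff u i| <= sq_upto u n.
Proof.
move=> ni; rewrite /sq_upto -[leLHS]ger0_norm// -sqrtr_sqr ler_sqrt; last first.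
  by apply: sumr_ge0 => j _; exact: sqr_ge0.
rewrite (bigD1 (inord i)) //= inordK// lerDl; apply: sumr_ge0 => j _; exact: sqr_ge0.
Qed.

(** The growing factor is harmless: the bound serves only at fixed [n], for integrability and for
    pointwise convergence. *)
Lemma norm_le_sq_upto u n : `|u n| <= n.+1%:R * sq_upto u n.
Proof.
rewrite -[in leLHS](sum_seq_diff u); apply: le_trans (ler_norm_sum _ _ _) _.
rewrite -[n.+1 in X in _ <= X * _]card_ord mulrC -sumr_const mulr_sumr.
by apply: ler_sum => i _; rewrite mulr1; apply: norm_seq_diff_sq_upto; rewrite -ltnS.
Qed.

Lemma norm_le_abs_at u n : `|u n| <= n.+1%:R * abs_at u n.
Proof. by rewrite /abs_at -[leLHS]mul1r ler_wpM2r// ler1n. Qed.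

End stopped_sequences.

(** * Dyadic sums *)

Section dyadic.
Context (R : realType).
Implicit Types (a b G q : R) (u : int -> R).

Lemma zpsum_sym_recr u N :
  zpsum u (N.+1, N.+1) = u (- N.+1%:Z) + zpsum u (N, N) + u N.+1%:Z.
Proof.
rewrite /zpsum /= addnS addSn big_ord_recr big_ord_recl /= sub0r.
congr (_ + _ + _); last by congr u; lia.
by apply: eq_bigr => i _; congr u; rewrite /bump /=; lia.
Qed.

Lemma zpsum_sym_le u m n : (forall k, 0 <= u k) -> (m <= n)%N ->
  zpsum u (m, m) <= zpsum u (n, n).
Proof.
move=> u0; move: m n; apply/nondecreasing_seqP => n.
by rewrite zpsum_sym_recr; have := u0 (- n.+1%:Z); have := u0 n.+1%:Z; lra.
Qed.

(** Enumerates 0, -1, 1, -2, 2, ..., so that the first [2N + 1] values exhaust the window from [-N]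
    to [N]. *)
Let zigzag (n : nat) : int := if odd n then Negz n./2 else Posz n./2.

Let zigzag_bij : set_bij [set: nat] [set: int] zigzag.
Proof.
split=> //.
- move=> m n _ _; rewrite /zigzag.
  have := odd_double_half m; have := odd_double_half n.
  by case: (odd m); case: (odd n) => //= h1 h2 []; lia.
- move=> [k|k] _ /=; [exists k.*2|exists k.*2.+1] => //; rewrite /zigzag.
    by rewrite odd_double doubleK.
  by rewrite /= odd_double /= uphalf_double.
Qed.

Let sum_zigzag u N : \sum_(i < (N + N).+1) u (zigzag i) = zpsum u (N, N).
Proof.
elim: N => [|N IH]; first by rewrite /zpsum !big_ord1.
rewrite zpsum_sym_recr -IH addnS addSn 2!big_ord_recr /=; congr (_ + _).
  rewrite addrC; congr (u _ + _); rewrite /zigzag /= addnn odd_double /=.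
  by rewrite uphalf_double NegzE.
by congr u; rewrite /zigzag /= addnn odd_double /= doubleK.
Qed.

Lemma esum_zpsum_le u (B : R) : (forall k, 0 <= u k) ->
  (\esum_(k in [set: int]) (u k)%:E <= B%:E)%E <->
  (forall N, zpsum u (N, N) <= B).
Proof.
move=> u0; rewrite (reindex_esum _ _ _ _ zigzag_bij).
have nnu n : (0 <= (u (zigzag n))%:E)%E by rewrite lee_fin.
have -> : [set: nat] = [set n | xpredT n] by apply/seteqP; split.
rewrite -(@nneseries_esum _ (fun n => (u (zigzag n))%:E) xpredT)//.
have sE n : (\sum_(0 <= k < n) (u (zigzag k))%:E)%E = (\sum_(k < n) u (zigzag k))%:E.
  by rewrite big_mkord sumEFin.
split=> [h N|h].
  rewrite -sum_zigzag -lee_fin; apply: le_trans h; rewrite -sE.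
  exact: (@nneseries_lim_ge _ (fun n => (u (zigzag n))%:E)).
apply: lime_le; first exact: is_cvg_nneseries.
apply: nearW => n; rewrite sE lee_fin; apply: le_trans (h n).
rewrite -sum_zigzag.
have le_n : (n <= (n + n).+1)%N by lia.
by rewrite -!(big_mkord xpredT (u \o zigzag)) (big_cat_nat _ le_n) //= lerDl sumr_ge0.
Qed.

Lemma zpsum_scale (r : R) u jm : zpsum (fun k => r * u k) jm = r * zpsum u jm.
Proof. by rewrite /zpsum mulr_sumr. Qed.

Lemma powR2N_lt1 q : 0 < q -> 2 `^ (- q) < 1.
Proof.
move=> q0; rewrite powRN invf_lt1 ?powR_gt0//.
apply: (@le_lt_trans _ _ (1 `^ q)); first by rewrite powR1.
by apply: gt0_ltr_powR; rewrite ?nnegrE ?ltr1n.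
Qed.

(** A geometric sum is comparable to its largest term. Capping [G] by the top level [2^(n-1) * b]
    makes the induction close: adding a term [t^q] needs [C0 * 2^(-q) * t^q + t^q <= C0 * t^q],
    which is the hypothesis on [C0]. *)
Lemma sum_dyadic_le C0 G q b n : 0 < q -> 0 <= G -> 0 < b ->
  1 <= C0 * (1 - 2 `^ (- q)) ->
  \sum_(i < n) (if 2 ^+ i * b < G then (2 ^+ i * b) `^ q else 0) <=
  C0 * (Num.min G (2 ^+ n * b / 2)) `^ q.
Proof.
move=> q0 G0 b0 C0q.
have r1 := powR2N_lt1 q0.
have r0 : 0 < 2 `^ (- q) :> R by rewrite powR_gt0.
have C0p : 0 < C0 by nra.
have t0 i : 0 < 2 ^+ i * b by rewrite mulr_gt0// exprn_gt0.
have mono x y : 0 <= x -> x <= y -> x `^ q <= y `^ q.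
  by move=> x0 xy; apply: ge0_ler_powR; rewrite ?nnegrE ?(ltW q0)// (le_trans x0).
elim: n => [|n IH].
  by rewrite big_ord0 mulr_ge0 ?powR_ge0// ltW.
have tS : 2 ^+ n.+1 * b / 2 = 2 ^+ n * b by rewrite exprS; field.
rewrite big_ord_recr /= tS; case: ifPn => [h|h]; last first.
  rewrite addr0; apply: le_trans IH _; rewrite ler_pM2l//; apply: mono.
    by rewrite le_min G0 divr_ge0// ltW.
  rewrite le_min ge_min lexx /= ge_min; apply/orP; right.
  by have := t0 n; lra.
rewrite (min_r (ltW h)).
apply: (@le_trans _ _ (C0 * (2 ^+ n * b / 2) `^ q + (2 ^+ n * b) `^ q)).
  rewrite lerD2r; apply: le_trans IH _; rewrite ler_pM2l//; apply: mono.
    by rewrite le_min G0 divr_ge0// ltW.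
  by rewrite ge_min lexx orbT.
rewrite powRM ?(ltW (t0 _))//.
have -> : (2^-1 : R) `^ q = 2 `^ (- q).
  by rewrite -(powR_inv1 (ler0n _ 2)) -powRrM mulN1r.
have := powR_gt0 q (t0 n); move: (_ `^ q) => t tp; nra.
Qed.

(** One term suffices: levels being a factor 2 apart, the largest one below [G] is at least
    [G / 2]. *)
Lemma sum_dyadic_ge G q b n : 0 < q -> 0 < b -> b < G -> G <= 2 ^+ n * b ->
  (G / 2) `^ q <=
  \sum_(i < n) (if 2 ^+ i * b < G then (2 ^+ i * b) `^ q else 0).
Proof.
move=> q0 b0 bG; elim: n => [|n IH]; first by rewrite mul1r => /(lt_le_trans bG); rewrite ltxx.
rewrite big_ord_recr /=; case: ltP => h h1; last by rewrite addr0 IH.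
apply: (@le_trans _ _ ((2 ^+ n * b) `^ q)).
  have t0 : 0 < 2 ^+ n * b by rewrite mulr_gt0// exprn_gt0.
  by apply: ge0_ler_powR; rewrite ?nnegrE ?(ltW q0) ?(ltW t0)//; move: h1; rewrite exprS; lra.
rewrite lerDr; apply: sumr_ge0 => i _; case: ifP => // _; exact: powR_ge0.
Qed.

Lemma zpsum_dyadic (F : R -> R) N : zpsum (fun k => F (2 ^ k)) (N, N) =
  \sum_(i < (N + N).+1) F (2 ^+ i * 2 ^ (- N%:Z)).
Proof. by apply: eq_bigr => i _ /=; rewrite expfzDr// -exprnP. Qed.

Lemma zpsum_dyadic_le C0 G q N : 0 < q -> 0 <= G ->
  1 <= C0 * (1 - 2 `^ (- q)) ->
  zpsum (fun k => if 2 ^ k < G then (2 ^ k) `^ q else 0) (N, N) <= C0 * G `^ q.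
Proof.
move=> q0 G0 C0q; rewrite (zpsum_dyadic (fun t => if t < G then t `^ q else 0)).
have b0 : 0 < 2 ^ (- N%:Z) :> R by rewrite exprz_gt0.
apply: le_trans (sum_dyadic_le _ q0 G0 b0 C0q) _.
have r1 := powR2N_lt1 q0.
rewrite ler_pM2l; last by nra.
apply: ge0_ler_powR; rewrite ?nnegrE ?(ltW q0)//; last by rewrite ge_min lexx.
by rewrite le_min G0 divr_ge0// mulr_ge0 ?exprn_ge0 ?exprz_ge0.
Qed.

Lemma two_expr_gt (y : R) : exists N, forall n, (N <= n)%N -> y < 2 ^+ n.
Proof.
exists (Num.truncn y).+1 => n Nn; apply: lt_le_trans (truncnS_gt y) _.
by rewrite -natrX ler_nat; apply: leq_trans Nn (ltnW (ltn_expl _ _)).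
Qed.

Lemma zpsum_dyadic_ge G q : 0 < q -> 0 < G -> exists N,
  (G / 2) `^ q <= zpsum (fun k => if 2 ^ k < G then (2 ^ k) `^ q else 0) (N, N).
Proof.
move=> q0 G0.
have [N1 h1] := two_expr_gt G; have [N2 h2] := two_expr_gt G^-1.
(* This window of levels straddles [G]: [2^(-N) < G < 2^N]. *)
exists (maxn N1 N2); rewrite (zpsum_dyadic (fun t => if t < G then t `^ q else 0)).
set N := maxn _ _.
have e0 : 0 < 2 ^+ N :> R by exact: exprn_gt0.
have eE : 2 ^ (- N%:Z) = (2 ^+ N)^-1 :> R by rewrite -invr_expz.
apply: sum_dyadic_ge => //.
  by rewrite eE -(invrK G) ltf_pV2 ?posrE ?invr_gt0// h2// leq_maxr.
rewrite eE exprS exprD -mulrA -mulrA divff ?gt_eqF// mulr1.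
by have := h1 N (leq_maxl _ _); lra.
Qed.

End dyadic.

(** * The Luxemburg quasi-norm *)

Section exponent_bounds.
Context (R : realType).
Implicit Types (t q a b : R).

Lemma powR_le_exp t q a : 0 <= t <= 1 -> 0 < a <= q -> t `^ q <= t `^ a.
Proof.
move=> /andP[t0 t1] /andP[a0 aq]; have [->|tn0] := eqVneq t 0.
  by rewrite !powR0// gt_eqF// (lt_le_trans a0).
by apply: ger_powR => //; rewrite t1 andbT lt_neqAle eq_sym tn0.
Qed.

Lemma powR_homo q a b : 0 <= q -> 0 <= a -> a <= b -> a `^ q <= b `^ q.
Proof. by move=> q0 a0 ab; apply: ge0_ler_powR; rewrite ?nnegrE// (le_trans a0). Qed.

Lemma powRV_le q a b : 0 < q -> 0 <= a -> 0 <= b -> a `^ q^-1 <= b -> a <= b `^ q.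
Proof.
move=> q0 a0 b0 ab.
rewrite -[leLHS]powRr1// -(mulVf (lt0r_neq0 q0)) powRrM.
by apply: powR_homo; rewrite ?powR_ge0 ?(ltW q0).
Qed.

Lemma powR_leV q a b : 0 < q -> 0 <= a -> 0 <= b -> a <= b `^ q^-1 -> a `^ q <= b.
Proof.
move=> q0 a0 b0 ab.
rewrite -[leRHS]powRr1// -(mulVf (lt0r_neq0 q0)) powRrM.
by apply: powR_homo; rewrite ?powR_ge0 ?(ltW q0).
Qed.

Lemma powR_Vle q a b : 0 < q -> 0 <= a -> 0 <= b -> a <= b `^ q -> a `^ q^-1 <= b.
Proof. by move=> q0 a0 b0 ab; apply: powR_leV; rewrite ?invr_gt0// invrK. Qed.

Lemma powR_le_inj q a b : 0 < q -> 0 <= a -> 0 <= b -> a `^ q <= b `^ q -> a <= b.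
Proof.
move=> q0 a0 b0; apply: contraTT; rewrite -!ltNge => ba.
by apply: gt0_ltr_powR => //; rewrite nnegrE.
Qed.

Lemma powRV q a : 0 <= a -> a^-1 `^ q = (a `^ q)^-1.
Proof. by move=> a0; rewrite -(powR_inv1 a0) -powRrM mulN1r powRN. Qed.

End exponent_bounds.

Section luxemburg.
Context d (T : measurableType d) (R : realType) (P : probability T R).
Variables (p : T -> R) (Hp : variable_exponent P p).

Let pm := exponent_minus P p.
Let pp := exponent_plus P p.

Let mp : measurable_fun setT p. Proof. by case: Hp. Qed.
Let p_gt0 x : 0 < p x. Proof. by case: Hp => _ + _ _; apply. Qed.

Let PT : (0 < P setT)%E. Proof. by rewrite probability_setT lte01. Qed.

Let inf_le_sup : (ess_inf P (EFin \o p) <= ess_sup P (EFin \o p))%E.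
Proof. by apply: ess_sup_gee => //; exact: ess_inf_le. Qed.

Let pmE : (pm%:E = ess_inf P (EFin \o p))%E.
Proof.
case: Hp => _ _ h1 h2; rewrite /pm /exponent_minus fineK// fin_real//.
by rewrite (lt_trans _ h1)// (le_lt_trans inf_le_sup).
Qed.

Let ppE : (pp%:E = ess_sup P (EFin \o p))%E.
Proof.
case: Hp => _ _ h1 h2; rewrite /pp /exponent_plus fineK// fin_real//.
by rewrite h2 andbT (lt_le_trans _ inf_le_sup)// (lt_trans _ h1).
Qed.

Lemma exponent_minus_gt0 : 0 < pm.
Proof. by rewrite -lte_fin pmE; case: Hp. Qed.

Lemma exponent_minus_le_plus : pm <= pp.
Proof. by rewrite -lee_fin pmE ppE. Qed.

Lemma exponent_plus_gt0 : 0 < pp.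
Proof. exact: lt_le_trans exponent_minus_gt0 exponent_minus_le_plus. Qed.

Lemma ae_exponent_bounds : {ae P, forall x, pm <= p x <= pp}.
Proof.
have h1 := ess_inf_le P (EFin \o p); have h2 := ess_sup_ge P (EFin \o p).
apply: filterS2 h1 h2 => x /=; rewrite -pmE -ppE !lee_fin => -> ->//.
Qed.

Lemma measurable_powR_var (w : T -> R) : measurable_fun setT w ->
  measurable_fun setT (fun x => w x `^ p x).
Proof.
move=> mw.
have -> : (fun x => w x `^ p x) =
    (fun x => if w x == 0 then 0 else expR (p x * ln (w x))).
  by apply/funext => x; rewrite /powR (gt_eqF (p_gt0 x)).
apply: measurable_fun_ifT.
- by apply: measurable_fun_eqr => //; exact: measurable_cst.
- exact: measurable_cst.
- apply: measurableT_comp; first exact: measurable_expR.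
  apply: measurable_funM => //.
  by apply: measurableT_comp => //; exact: measurable_ln.
Qed.

Lemma measurable_poweR_var (u : T -> \bar R) : measurable_fun setT u ->
  measurable_fun setT (fun x => (`|u x| `^ p x)%E).
Proof.
move=> mu.
have -> : (fun x => (`|u x| `^ p x)%E) =
   (fun x => if `|u x|%E == +oo%E then +oo%E else (fine `|u x|%E `^ p x)%:E).
  apply/funext => x; rewrite poweRE gt_eqF//.
  by case: (u x) => [r||]//=.
have mau : measurable_fun setT (fun x => `|u x|%E).
  by apply: measurableT_comp => //; exact: abse_measurable.
apply: measurable_fun_ifT.
- by apply: measurable_fun_eqe => //; exact: measurable_cst.
- exact: measurable_cst.
- apply/measurable_EFinP; apply: measurable_powR_var.
  by apply: (measurableT_comp _ mau); exact: fine_measurable.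
Qed.

Lemma modular_le_ae (u v : T -> \bar R) :
  measurable_fun setT u -> measurable_fun setT v ->
  {ae P, forall x, (`|u x| <= `|v x|)%E} -> (modular P p u <= modular P p v)%E.
Proof.
move=> mu mv uv; apply: ae_ge0_le_integral => //.
- by move=> x _; exact: poweR_ge0.
- exact: measurable_poweR_var.
- by move=> x _; exact: poweR_ge0.
- exact: measurable_poweR_var.
- apply: filterS uv => x uv _; apply: gt0_ler_poweR => //.
  + exact: ltW.
  + by rewrite in_itv /= abse_ge0 leey.
  + by rewrite in_itv /= abse_ge0 leey.
Qed.

Lemma luxnorm_ge0 (u : T -> \bar R) : (0 <= luxnorm P p u)%E.
Proof. by apply: le_ereal_inf_tmp => _ [g [g0 _] <-]; rewrite lee_fin ltW. Qed.

Lemma luxnorm_le (u : T -> \bar R) (s : R) : 0 < s ->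
  (modular P p (fun x => u x * s^-1%:E) <= 1)%E -> (luxnorm P p u <= s%:E)%E.
Proof. by move=> s0 h; apply: ereal_inf_lbound; exists s. Qed.

(** The strict inequality provides an admissible scale below [s], whether or not the infimum is
    attained, and the modular decreases as the scale grows. *)
Lemma luxnorm_lt_modular (u : T -> \bar R) (s : R) : measurable_fun setT u ->
  (luxnorm P p u < s%:E)%E -> (modular P p (fun x => u x * s^-1%:E) <= 1)%E.
Proof.
move=> mu /ereal_inf_lt[_ [g [g0 h] <-]]; rewrite lte_fin => gs.
apply: le_trans h; apply: modular_le_ae.
- by apply: emeasurable_funM => //; exact: measurable_cst.
- by apply: emeasurable_funM => //; exact: measurable_cst.
- apply: aeW => x; rewrite !abseM lee_wpmul2l ?abse_ge0//=.
  have s0 := lt_trans g0 gs.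
  by rewrite lee_fin !gtr0_norm ?invr_gt0// lef_pV2 ?posrE// ltW.
Qed.

Lemma luxnorm_le_ae (u v : T -> \bar R) :
  measurable_fun setT u -> measurable_fun setT v ->
  {ae P, forall x, (`|u x| <= `|v x|)%E} -> (luxnorm P p u <= luxnorm P p v)%E.
Proof.
move=> mu mv uv; apply: le_ereal_inf_tmp => _ [g [g0 h] <-].
apply: luxnorm_le => //; apply: le_trans h; apply: modular_le_ae.
- by apply: emeasurable_funM => //; exact: measurable_cst.
- by apply: emeasurable_funM => //; exact: measurable_cst.
- by apply: filterS uv => x uv; rewrite !abseM lee_wpmul2r ?abse_ge0.
Qed.

Lemma eq_luxnorm_ae (u v : T -> \bar R) :
  measurable_fun setT u -> measurable_fun setT v ->
  {ae P, forall x, u x = v x} -> luxnorm P p u = luxnorm P p v.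
Proof.
move=> mu mv uv; apply/eqP; rewrite eq_le.
by apply/andP; split; apply: luxnorm_le_ae => //; apply: filterS uv => x ->.
Qed.

Lemma luxnorm_fin_ae (u : T -> \bar R) : measurable_fun setT u ->
  (luxnorm P p u < +oo)%E -> {ae P, forall x, u x \is a fin_num}.
Proof.
move=> mu /ereal_inf_lt[_ [g [g0 h] <-]] _.
have mv : measurable_fun setT (fun x => u x * g^-1%:E)%E.
  by apply: emeasurable_funM => //; exact: measurable_cst.
have : P.-integrable setT (fun x => `|u x * g^-1%:E| `^ p x)%E.
  apply/integrableP; split; first exact: measurable_poweR_var.
  under eq_integral do rewrite gee0_abs ?poweR_ge0//.
  by apply: le_lt_trans h _; rewrite ltry.
move=> /(integrable_ae measurableT); apply: filterS => x /(_ I).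
have gv0 : 0 < g^-1 by rewrite invr_gt0.
case: (u x) => [r||]//=.
  by rewrite gt0_mulye ?lte_fin// poweRyr// gt_eqF.
by rewrite gt0_mulNye ?lte_fin// poweRyr// gt_eqF.
Qed.

Lemma modular_EFin (w : T -> R) (s : R) : (forall x, 0 <= w x) -> 0 < s ->
  modular P p (fun x => (w x)%:E * s^-1%:E)%E = (\int[P]_x ((w x / s) `^ p x)%:E)%E.
Proof.
move=> w0 s0; apply: eq_integral => x _.
by rewrite /= ger0_norm// divr_ge0// ltW.
Qed.

Lemma luxnorm_EFin_le (w : T -> R) (s : R) : (forall x, 0 <= w x) -> 0 < s ->
  (\int[P]_x ((w x / s) `^ p x)%:E <= 1)%E -> (luxnorm P p (EFin \o w) <= s%:E)%E.
Proof. by move=> w0 s0 h; apply: luxnorm_le => //; rewrite (modular_EFin w0 s0). Qed.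

Lemma luxnorm_EFin_lt (w : T -> R) (s : R) : measurable_fun setT w ->
  (forall x, 0 <= w x) -> 0 < s -> (luxnorm P p (EFin \o w) < s%:E)%E ->
  (\int[P]_x ((w x / s) `^ p x)%:E <= 1)%E.
Proof.
move=> mw w0 s0 h; rewrite -(modular_EFin w0 s0).
by apply: (@luxnorm_lt_modular (EFin \o w)) => //; exact/measurable_EFinP.
Qed.

(** Shrinking the scale by a factor [c <= 1] multiplies the modular by at most [c^(-p^+)], so
    [c = I^(1/p^+)] brings it to at most 1. *)
Lemma luxnorm_le_root (w : T -> R) (s I : R) : measurable_fun setT w ->
  (forall x, 0 <= w x) -> 0 < s -> 0 <= I <= 1 ->
  (\int[P]_x ((w x / s) `^ p x)%:E <= I%:E)%E ->
  (luxnorm P p (EFin \o w) <= (s * I `^ pp^-1)%:E)%E.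
Proof.
move=> mw w0 s0 /andP[I0 I1] hI; apply/lee_addgt0Pr => e e0.
have pp0 := exponent_plus_gt0.
(* The slack [e / s] keeps [c] positive when [I = 0]; the cap at 1 is what allows comparing
   [c^(p x)] with [c^(p^+)]. *)
pose c := Num.min 1 (I `^ pp^-1 + e / s).
have es0 : 0 < e / s by rewrite divr_gt0.
have c0 : 0 < c by rewrite lt_min ltr01 /= ltr_wpDl// powR_ge0.
have c1 : c <= 1 by rewrite ge_min lexx.
have Ic : I <= c `^ pp.
  rewrite /c; case: (leP 1 (I `^ pp^-1 + e / s)) => h; first by rewrite powR1.
  by apply: powRV_le; rewrite ?lerDl ?addr_ge0 ?powR_ge0 ?(ltW es0).
have sc0 : 0 < s * c by rewrite mulr_gt0.
apply: (@le_trans _ _ (s * c)%:E); last first.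
  rewrite -EFinD lee_fin (_ : s * I `^ pp^-1 + e = s * (I `^ pp^-1 + e / s)).
    by rewrite ler_pM2l// ge_min lexx orbT.
  by field; rewrite gt_eqF.
apply: luxnorm_le => //; rewrite modular_EFin//.
have mws : measurable_fun setT (fun x => ((w x / s) `^ p x)%:E).
  by apply/measurable_EFinP/measurable_powR_var/measurable_funM.
apply: (@le_trans _ _ (\int[P]_x ((c `^ pp)^-1%:E * ((w x / s) `^ p x)%:E))%E).
  apply: ae_ge0_le_integral => //.
  - by move=> x _; rewrite lee_fin powR_ge0.
  - by apply/measurable_EFinP/measurable_powR_var/measurable_funM.
  - by move=> x _; rewrite -EFinM lee_fin mulr_ge0 ?invr_ge0 ?powR_ge0.
  - exact: emeasurable_funM.
  apply: filterS ae_exponent_bounds => x /andP[pmp ppp] _.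
  rewrite -EFinM lee_fin invfM mulrA powRM ?divr_ge0 ?(ltW s0) ?invr_ge0 ?(ltW c0)//.
  rewrite mulrC ler_wpM2r ?powR_ge0//.
  rewrite (powRV _ (ltW c0)).
  by rewrite lef_pV2 ?posrE ?powR_gt0//; apply: powR_le_exp; rewrite ?(ltW c0) ?p_gt0.
rewrite ge0_integralZl_EFin//; last 2 first.
  by move=> x _; rewrite lee_fin powR_ge0.
  by rewrite invr_ge0 powR_ge0.
apply: (@le_trans _ _ ((c `^ pp)^-1%:E * I%:E)%E).
  by rewrite lee_wpmul2l// lee_fin invr_ge0 powR_ge0.
by rewrite -EFinM lee_fin mulrC ler_pdivrMr ?powR_gt0// mul1r.
Qed.

(** In [w / s = (c / s) * (w / c)] the factor [c / s <= 1] comes out with the smallest exponent, and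
    the modular at scale [c] is at most 1 for every [c > b]; then [c] tends to [b]. *)
Lemma modular_le_pow (w : T -> R) (b s : R) : measurable_fun setT w ->
  (forall x, 0 <= w x) -> 0 <= b -> b < s ->
  (luxnorm P p (EFin \o w) <= b%:E)%E ->
  (\int[P]_x ((w x / s) `^ p x)%:E <= ((b / s) `^ pm)%:E)%E.
Proof.
move=> mw w0 b0 bs hb; have pm0 := exponent_minus_gt0.
have s0 : 0 < s := le_lt_trans b0 bs.
set X := (\int[P]_x _)%E.
have X0 : (0 <= X)%E by apply: integral_ge0 => x _; rewrite lee_fin powR_ge0.
have key c : b < c -> c <= s -> (X <= ((c / s) `^ pm)%:E)%E.
  move=> bc cs; have c0 : 0 < c := le_lt_trans b0 bc.
  have : (luxnorm P p (EFin \o w) < c%:E)%E by rewrite (le_lt_trans hb).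
  move/luxnorm_lt_modular => /(_ ltac:(exact/measurable_EFinP)).
  rewrite modular_EFin// => h.
  have mwc : measurable_fun setT (fun x => ((w x / c) `^ p x)%:E).
    by apply/measurable_EFinP/measurable_powR_var/measurable_funM.
  apply: (@le_trans _ _ (\int[P]_x (((c / s) `^ pm)%:E * ((w x / c) `^ p x)%:E))%E).
    apply: ae_ge0_le_integral => //.
    - by move=> x _; rewrite lee_fin powR_ge0.
    - by apply/measurable_EFinP/measurable_powR_var/measurable_funM.
    - by move=> x _; rewrite -EFinM lee_fin mulr_ge0 ?powR_ge0.
    - exact: emeasurable_funM.
    apply: filterS ae_exponent_bounds => x /andP[pmp ppp] _.
    rewrite -EFinM lee_fin.
    have -> : w x / s = (c / s) * (w x / c) by field; rewrite !gt_eqF.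
    have cs0 : 0 <= c / s by rewrite divr_ge0 ?ltW.
    have wc0 : 0 <= w x / c by rewrite divr_ge0 ?(ltW c0).
    rewrite (powRM (p x) cs0 wc0) ler_wpM2r ?powR_ge0//.
    by apply: powR_le_exp; rewrite ?cs0 ?pm0 ?pmp//= ler_pdivrMr// mul1r.
  rewrite ge0_integralZl_EFin ?powR_ge0//; last first.
    by move=> x _; rewrite lee_fin powR_ge0.
  by rewrite -[leRHS]mule1 lee_wpmul2l// lee_fin powR_ge0.
have Xfin : X \is a fin_num.
  by rewrite ge0_fin_numE// (le_lt_trans (key s bs (lexx _)))// ltry.
rewrite -(fineK Xfin) lee_fin.
apply: powRV_le; rewrite ?fine_ge0 ?divr_ge0 ?(ltW s0)//.
rewrite ler_pdivlMr//; apply/ler_addgt0Pr => e e0.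
(* [key] applies to [c = b + e] only up to [s]; beyond it, the integral being at most 1 is
   enough. *)
have [h|h] := leP (b + e) s.
  rewrite -ler_pdivlMr//; apply: powR_Vle; rewrite ?fine_ge0 ?divr_ge0 ?addr_ge0 ?(ltW s0) ?(ltW e0)//.
  by rewrite -lee_fin fineK// key// ltrDl.
apply: le_trans (ltW h); rewrite -[leRHS]mul1r ler_wpM2r ?(ltW s0)//.
apply: powR_Vle; rewrite ?fine_ge0// powR1 -lee_fin fineK//.
by rewrite (le_trans (key s bs (lexx _)))// divff ?gt_eqF// powR1.
Qed.

Lemma luxnorm_indic_le1 (B : set T) : measurable B ->
  (luxnorm P p (EFin \o \1_B) <= 1)%E.
Proof.
move=> mB; apply: luxnorm_le => //.
rewrite modular_EFin//.
apply: (@le_trans _ _ (\int[P]_x (cst 1%E x))%E); last first.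
  by rewrite integral_cst// mul1e; exact: probability_le1.
apply: ge0_le_integral => //.
- by apply/measurable_EFinP/measurable_powR_var/measurable_funM.
- move=> x _; rewrite lee_fin divr1 indicE.
  by case: (_ \in _); rewrite ?powR1// powR0// gt_eqF.
Qed.

Definition indic_norm (B : set T) : R := fine (luxnorm P p (EFin \o \1_B)).

Lemma indic_normE (B : set T) : measurable B ->
  luxnorm P p (EFin \o \1_B) = (indic_norm B)%:E.
Proof.
move=> mB; rewrite /indic_norm fineK// ge0_fin_numE ?luxnorm_ge0//.
by rewrite (le_lt_trans (luxnorm_indic_le1 mB))// ltry.
Qed.

Lemma indic_norm_ge0 (B : set T) : 0 <= indic_norm B.
Proof. by rewrite fine_ge0// luxnorm_ge0. Qed.

End luxemburg.

(** * Norms of level sets *)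

Section level_sets.
Context d (T : measurableType d) (R : realType) (P : probability T R).
Variables (p : T -> R) (Hp : variable_exponent P p).
Variables (G : T -> R) (mG : measurable_fun setT G) (G0 : forall x, 0 <= G x).

Let pm := exponent_minus P p.
Let pp := exponent_plus P p.
Let pm0 : 0 < pm := exponent_minus_gt0 Hp.
Let pp0 : 0 < pp := exponent_plus_gt0 Hp.
Let p_gt0 x : 0 < p x. Proof. by case: Hp => _ + _ _; apply. Qed.

Definition level_set (k : int) : set T := [set x | 2 ^ k < G x].

Lemma measurable_level_set k : measurable (level_set k).
Proof.
rewrite /level_set -[X in measurable X]setTI.
have -> : [set x | 2 ^ k < G x] = G @^-1` `]2 ^ k, +oo[.
  by apply/seteqP; split => x /=; rewrite in_itv /= andbT.
by apply: mG => //; exact: measurable_itv.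
Qed.

Let beta k := indic_norm P p (level_set k).

Let pow2_gt0 (k : int) : 0 < 2 ^ k :> R. Proof. by rewrite exprz_gt0. Qed.

(** The modular integrand of [2^k] times the level indicator at scale [s], written as that of the
    bare indicator at scale [s / 2^k]. *)
Let term s k x := (\1_(level_set k) x / (s / 2 ^ k)) `^ p x.

Let term_ge0 s k x : 0 <= term s k x. Proof. exact: powR_ge0. Qed.

Let termE s k x : 0 < s ->
  term s k x = (s `^ p x)^-1 * (if 2 ^ k < G x then (2 ^ k) `^ p x else 0).
Proof.
move=> s0; rewrite /term indicE.
have -> : (x \in level_set k) = (2 ^ k < G x) by apply/idP/idP; rewrite inE.
case: ifPn => _; last by rewrite mul0r powR0 ?mulr0// gt_eqF.
rewrite div1r invf_div mulrC powRM ?(ltW (pow2_gt0 k)) ?invr_ge0 ?(ltW s0)//.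
by rewrite powRV// ltW.
Qed.

Let measurable_term s k : measurable_fun setT (term s k).
Proof.
apply: (measurable_powR_var Hp); apply: measurable_funM => //.
by apply: measurable_indic; exact: measurable_level_set.
Qed.

Let integral_zpsum s N :
  (\int[P]_x (zpsum (fun k => term s k x) (N, N))%:E =
   \sum_(i < (N + N).+1) \int[P]_x (term s (i%:Z - N%:Z) x)%:E)%E.
Proof.
rewrite -ge0_integral_sum//.
- by apply: eq_integral => x _; rewrite sumEFin.
- by move=> i; apply/measurable_EFinP.
- by move=> i x _; rewrite lee_fin.
Qed.

(* The sum of [2^(-i * pm)] over [i >= 0] is [(1 - 2^(-pm))^-1]; the outer
   power turns it into a factor of the norm. *)
Definition level_constant : R := (1 - 2 `^ (- pm))^-1 `^ pm^-1.

Lemma level_constant_gt0 : 0 < level_constant.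
Proof. by rewrite powR_gt0// invr_gt0 subr_gt0 powR2N_lt1. Qed.

(** At scale [s * level_constant] the modulars of [2^k] times the level indicators sum to at most 1,
    by pointwise dyadic summation. [luxnorm_le_root] turns each into a norm, and the power [p^+]
    undoes the root, so that the bounds can be summed. *)
Lemma level_sum_le s N : 0 < s ->
  (\int[P]_x ((G x / s) `^ p x)%:E <= 1)%E ->
  zpsum (fun k => (2 ^ k * beta k) `^ pp) (N, N) <= (s * level_constant) `^ pp.
Proof.
move=> s0 hs.
have K0 := level_constant_gt0.
set K := level_constant in K0 *; set s' := s * K.
have s'0 : 0 < s' by rewrite mulr_gt0.
have r1 := powR2N_lt1 pm0.
pose C0 := (1 - 2 `^ (- pm) : R)^-1.
have C01 : 1 <= C0.
  by rewrite invf_ge1 ?subr_gt0// gerBl powR_ge0.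
have C0_gt0 : 0 < C0 := lt_le_trans ltr01 C01.
(* Together with [K^(p^-) = C0] this gives [C0 <= K^(p x)] almost everywhere: enlarging the scale by
   [K] absorbs the dyadic constant for all exponents at once. *)
have K1 : 1 <= K.
  by rewrite -(powRr0 C0) /K /level_constant -/C0 ler_powR// invr_ge0 ltW.
have KE : K `^ pm = C0.
  by rewrite /K /level_constant -powRrM mulVf ?gt_eqF// powRr1// ltW.
have hsum : (\sum_(i < (N + N).+1) \int[P]_x (term s' (i%:Z - N%:Z) x)%:E <= 1)%E.
  rewrite -integral_zpsum; apply: le_trans hs; apply: ae_ge0_le_integral => //.
  - by move=> x _; rewrite lee_fin sumr_ge0.
  - apply/measurable_EFinP; rewrite /zpsum /=.
    by apply: measurable_sum => i; exact: measurable_term.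
  - by move=> x _; rewrite lee_fin powR_ge0.
  - by apply/measurable_EFinP; apply: (measurable_powR_var Hp); exact: measurable_funM.
  apply: filterS (ae_exponent_bounds Hp) => x /andP[pmp _] _; rewrite lee_fin.
  rewrite (_ : zpsum _ _ = (s' `^ p x)^-1 *
    zpsum (fun k => if 2 ^ k < G x then (2 ^ k) `^ p x else 0) (N, N)); last first.
    by rewrite -zpsum_scale; apply: eq_bigr => i _; rewrite termE.
  have C0p : 1 <= C0 * (1 - 2 `^ (- p x)).
    rewrite /C0 mulrC ler_pdivlMr ?subr_gt0// mul1r lerB//.
    by rewrite ler_powR ?ler1n// lerN2.
  apply: (@le_trans _ _ ((s' `^ p x)^-1 * (C0 * G x `^ p x))).
    by rewrite ler_wpM2l ?invr_ge0 ?powR_ge0//; exact: zpsum_dyadic_le.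
  rewrite powRM ?G0 ?invr_ge0 ?(ltW s0)// (powRV _ (ltW s0)).
  rewrite /s' powRM ?(ltW s0) ?(ltW K0)// invfM mulrA mulrC ler_wpM2l ?powR_ge0//.
  rewrite -mulrA -[leRHS]mulr1 ler_wpM2l ?invr_ge0 ?powR_ge0//.
  rewrite mulrC ler_pdivrMr ?powR_gt0// mul1r -KE.
  exact: ler_powR.
set I := fun i : 'I_(N + N).+1 => (\int[P]_x (term s' (i%:Z - N%:Z) x)%:E)%E in hsum.
have I0 i : (0 <= I i)%E by apply: integral_ge0 => x _; rewrite lee_fin.
have I1 i : (I i <= 1)%E.
  apply: le_trans hsum; rewrite (bigD1 i)//= leeDl//.
  by apply: sume_ge0 => j _; exact: I0.
have Ifin i : I i \is a fin_num by rewrite ge0_fin_numE// (le_lt_trans (I1 i))// ltry.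
have hI : \sum_i fine (I i) <= 1.
  rewrite -lee_fin -sumEFin; apply: le_trans hsum; apply: lee_sum => i _.
  by rewrite fineK.
apply: (@le_trans _ _ (\sum_i s' `^ pp * fine (I i))); last first.
  by rewrite -mulr_sumr ler_piMr ?powR_ge0.
apply: ler_sum => i _ /=; set k := (i%:Z - N%:Z).
have I01 : 0 <= fine (I i) <= 1.
  have := I1 i; have := I0 i; rewrite -(fineK (Ifin i)); move: (fine _) => r.
  by rewrite !lee_fin => -> ->.
have sk0 : 0 < s' / 2 ^ k by rewrite divr_gt0.
have mk : measurable_fun setT (\1_(level_set k) : T -> R).
  by apply: measurable_indic; exact: measurable_level_set.
have ik0 x : 0 <= \1_(level_set k) x :> R by rewrite indicE ler0n.
have := luxnorm_le_root Hp mk ik0 sk0 I01.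
rewrite fineK// => /(_ (lexx _)).
rewrite (indic_normE Hp); last exact: measurable_level_set.
rewrite lee_fin -/(beta k) => hb.
have b0 : 0 <= beta k by exact: indic_norm_ge0.
apply: (@le_trans _ _ ((s' * fine (I i) `^ pp^-1) `^ pp)).
  apply: powR_homo; rewrite ?mulr_ge0 ?(ltW pp0) ?(ltW (pow2_gt0 k))//.
  by rewrite mulrC -ler_pdivlMr// mulrAC.
rewrite powRM ?powR_ge0 ?(ltW s'0)// -powRrM mulVf ?gt_eqF// powRr1//.
by case/andP: I01.
Qed.

(** Pointwise, a single level carries [(G / 2)^(p x)], whence the factor 2, so the modular of [G] at
    scale [2 * s] is below the sum of those of the levels. [modular_le_pow] bounds each by
    [(2^k * beta k / s)^(p^-)], and these sum to at most 1. *)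
Lemma le_level_luxnorm t : 0 <= t ->
  (forall N, zpsum (fun k => (2 ^ k * beta k) `^ pm) (N, N) <= t `^ pm) ->
  (luxnorm P p (EFin \o G) <= (2 * t)%:E)%E.
Proof.
move=> t0 ht; apply/lee_addgt0Pr => e e0.
(* Strictly above [t], because [modular_le_pow] asks for a scale strictly larger than the bound on
   the norm. *)
pose s := t + e / 2.
have ts : t < s by rewrite /s ltrDl divr_gt0.
have s0 : 0 < s := le_lt_trans t0 ts.
have s20 : 0 < 2 * s by rewrite mulr_gt0.
have -> : ((2 * t)%:E + e%:E = (2 * s)%:E)%E by rewrite -EFinD /s; congr EFin; field.
apply: luxnorm_le => //; rewrite modular_EFin//.
have b0 k : 0 <= beta k by exact: indic_norm_ge0.
have bt k : 2 ^ k * beta k <= t.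
  have kN : (absz (k + `|k|%N%:Z)%R < (`|k|%N + `|k|%N).+1)%N by lia.
  have : (2 ^ k * beta k) `^ pm <= t `^ pm.
    apply: le_trans (ht `|k|%N); rewrite /zpsum /= (bigD1 (Ordinal kN)) //=.
    have -> : (absz (k + `|k|%N%:Z)%R)%:Z - `|k|%N%:Z = k by lia.
    by rewrite lerDl sumr_ge0// => j _; exact: powR_ge0.
  by apply: powR_le_inj => //; exact: mulr_ge0 (ltW (pow2_gt0 k)) (b0 k).
(* The window that reaches [G x] depends on [x], so the comparison is with the limit in [N], which
   monotone convergence takes out of the integral. *)
pose h N x := (zpsum (fun k => term s k x) (N, N))%:E.
have mh N : measurable_fun setT (h N).
  by apply/measurable_EFinP; apply: measurable_sum => i; exact: measurable_term.
have h0 N x : (0 <= h N x)%E by rewrite lee_fin sumr_ge0.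
have hnd x : {homo h^~ x : n m / (n <= m)%N >-> (n <= m)%E}.
  by move=> m n mn; rewrite lee_fin; exact: zpsum_sym_le.
have hcvg x : cvgn (h^~ x) by exact: ereal_nondecreasing_is_cvgn.
apply: (@le_trans _ _ (\int[P]_x limn (h^~ x))%E).
  apply: ge0_le_integral => //.
  - by move=> x _; rewrite lee_fin powR_ge0.
  - by apply/measurable_EFinP; apply: (measurable_powR_var Hp); exact: measurable_funM.
  - by apply: (emeasurable_fun_cvg h) => // x _; exact: hcvg.
  move=> x _; have [Gx0|Gx0] := eqVneq (G x) 0.
    rewrite Gx0 mul0r powR0 ?gt_eqF//; apply: lime_ge => //.
    by apply: nearW => N; exact: h0.
  have Gx_gt0 : 0 < G x by rewrite lt_neqAle eq_sym Gx0 G0.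
  have [N hN] := zpsum_dyadic_ge (p_gt0 x) Gx_gt0.
  apply: (@le_trans _ _ (h N x)); last first.
    apply: lime_ge => //; exists N => // m /= Nm; exact: hnd.
  rewrite lee_fin (_ : zpsum _ _ = (s `^ p x)^-1 *
    zpsum (fun k => if 2 ^ k < G x then (2 ^ k) `^ p x else 0) (N, N)); last first.
    by rewrite -zpsum_scale; apply: eq_bigr => i _; rewrite termE.
  apply: (@le_trans _ _ ((s `^ p x)^-1 * (G x / 2) `^ p x)); last first.
    by rewrite ler_wpM2l// invr_ge0 powR_ge0.
  have -> : G x / (2 * s) = s^-1 * (G x / 2) by field; rewrite gt_eqF.
  have sV0 : 0 <= s^-1 by rewrite invr_ge0 ltW.
  by rewrite (powRM _ sV0 (divr_ge0 (G0 x) (ler0n _ 2))) (powRV _ (ltW s0)).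
rewrite monotone_convergence//; apply: lime_le.
  apply: ereal_nondecreasing_is_cvgn => m n mn; apply: ge0_le_integral => //.
  by move=> x _; exact: hnd.
apply: nearW => N; rewrite /h integral_zpsum.
apply: (@le_trans _ _ (\sum_(i < (N + N).+1)
   ((s `^ pm)^-1 * (2 ^ (i%:Z - N%:Z) * beta (i%:Z - N%:Z)) `^ pm)%:E)%E).
  apply: lee_sum => i _; set k := (i%:Z - N%:Z).
  have bs : beta k < s / 2 ^ k.
    by rewrite ltr_pdivlMr// mulrC (le_lt_trans (bt k)).
  have mk : measurable_fun setT (\1_(level_set k) : T -> R).
    by apply: measurable_indic; exact: measurable_level_set.
  have ik0 x : 0 <= \1_(level_set k) x :> R by rewrite indicE ler0n.
  apply: le_trans (modular_le_pow Hp mk ik0 (b0 k) bs _) _.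
    by rewrite (indic_normE Hp)//; exact: measurable_level_set.
  rewrite lee_fin -/pm.
  have -> : beta k / (s / 2 ^ k) = s^-1 * (2 ^ k * beta k).
    by field; rewrite !gt_eqF.
  rewrite powRM ?invr_ge0 ?mulr_ge0 ?(ltW s0) ?(ltW (pow2_gt0 k))//.
  by rewrite (powRV _ (ltW s0)).
rewrite sumEFin lee_fin -mulr_sumr mulrC ler_pdivrMr ?powR_gt0// mul1r.
apply: le_trans (ht N) _; apply: powR_homo => //; exact: ltW.
Qed.

End level_sets.

(** * Expectations and orthogonality *)

Section expectation.
Context d (T : measurableType d) (R : realType) (P : probability T R).
Implicit Types (X Y h : T -> R) (A : set T) (G : set (set T)).

Definition intg X : Prop := P.-integrable setT (EFin \o X).

Lemma intg_measurable X : intg X -> measurable_fun setT X.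
Proof. by move=> /measurable_int /measurable_EFinP. Qed.

Lemma intgD X Y : intg X -> intg Y -> intg (fun x => X x + Y x).
Proof. exact: integrableD. Qed.

Lemma intgB X Y : intg X -> intg Y -> intg (fun x => X x - Y x).
Proof. exact: integrableB. Qed.

Lemma intgZ (r : R) X : intg X -> intg (fun x => r * X x).
Proof. exact: integrableZl. Qed.

Lemma intg_cst (r : R) : intg (fun=> r).
Proof. exact: finite_measure_integrable_cst. Qed.

Lemma intg_norm X : intg X -> intg (fun x => `|X x|).
Proof. exact: integrable_norm. Qed.

Lemma intg_sum n (X : nat -> T -> R) : (forall i, intg (X i)) ->
  intg (fun x => \sum_(i < n) X i x).
Proof.
move=> iX; elim: n => [|n IH].
  under [X in intg X]eq_fun do rewrite big_ord0; exact: intg_cst.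
by under [X in intg X]eq_fun do rewrite big_ord_recr /=; exact: intgD.
Qed.

Lemma intg_dominated_ae X Y : measurable_fun setT X -> intg Y ->
  {ae P, forall x, `|X x| <= Y x} -> intg X.
Proof.
move=> mX iY XY; have mY := intg_measurable iY.
apply/integrableP; split; first exact/measurable_EFinP.
move: (iY) => /integrableP[_]; apply: le_lt_trans.
apply: ae_ge0_le_integral => //.
- by apply: measurableT_comp => //; exact/measurable_EFinP.
- by apply: measurableT_comp => //; exact/measurable_EFinP.
- by apply: filterS XY => x h _; rewrite /= lee_fin (le_trans h)// ler_norm.
Qed.

Lemma intgM_bounded_ae h X (c : R) : measurable_fun setT h -> intg X ->
  {ae P, forall x, `|h x| <= c} -> intg (fun x => h x * X x).
Proof.
move=> mh iX hc; apply: (@intg_dominated_ae _ (fun x => c * `|X x|)).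
- by apply: measurable_funM => //; exact: intg_measurable.
- exact/intgZ/intg_norm.
- by apply: filterS hc => x hx; rewrite normrM ler_wpM2r.
Qed.

Lemma intgM_indic A X : measurable A -> intg X -> intg (fun x => \1_A x * X x).
Proof.
move=> mA iX; apply: (@intgM_bounded_ae _ _ 1) => //.
by apply: aeW => x; rewrite indicE normr_nat; case: (_ \in _); rewrite ?ler01.
Qed.

Definition expect X : R := \int[P]_x X x.

Lemma expectD X Y : intg X -> intg Y ->
  expect (fun x => X x + Y x) = expect X + expect Y.
Proof. exact: RintegralD. Qed.

Lemma expectB X Y : intg X -> intg Y ->
  expect (fun x => X x - Y x) = expect X - expect Y.
Proof. exact: RintegralB. Qed.

Lemma expectZ (r : R) X : intg X -> expect (fun x => r * X x) = r * expect X.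
Proof. exact: RintegralZl. Qed.

Lemma expect_cst (r : R) : expect (fun=> r) = r.
Proof.
have := Rintegral_cst P measurableT r.
by rewrite /expect => ->; have /= -> := @probability_setT _ _ _ P; rewrite mulr1.
Qed.

Lemma eq_expect X Y : X =1 Y -> expect X = expect Y.
Proof. by move=> XY; apply: eq_Rintegral => x _; exact: XY. Qed.

Lemma expect_sum n (X : nat -> T -> R) : (forall i, intg (X i)) ->
  expect (fun x => \sum_(i < n) X i x) = \sum_(i < n) expect (X i).
Proof.
move=> iX; elim: n => [|n IH].
  by rewrite big_ord0 -[RHS](expect_cst 0); apply: eq_expect => x; rewrite big_ord0.
rewrite big_ord_recr /= -IH -expectD//; last exact: intg_sum.
by apply: eq_expect => x; rewrite big_ord_recr.
Qed.

Lemma expectE X : intg X -> (\int[P]_x (X x)%:E = (expect X)%:E)%E.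
Proof. by move=> iX; rewrite /expect /Rintegral fineK// integrable_fin_num. Qed.

Lemma ae_eq_expect X Y : measurable_fun setT X -> measurable_fun setT Y ->
  {ae P, forall x, X x = Y x} -> expect X = expect Y.
Proof.
move=> mX mY XY; congr fine; apply: ae_eq_integral => //.
- exact/measurable_EFinP.
- exact/measurable_EFinP.
- by apply: filterS XY => x -> _.
Qed.

Lemma le_expect X Y : intg X -> intg Y ->
  {ae P, forall x, X x <= Y x} -> expect X <= expect Y.
Proof.
move=> iX iY XY.
have mX := intg_measurable iX; have mY := intg_measurable iY.
have mM : measurable_fun setT (fun x => Num.max (X x) (Y x)) by exact: measurable_maxr.
have YE : {ae P, forall x, Y x = Num.max (X x) (Y x)}.
  by apply: filterS XY => x h; rewrite max_r.
rewrite (ae_eq_expect mY mM YE); apply: le_Rintegral => //.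
- apply: intg_dominated_ae mM (intg_norm iY) _.
  by apply: filterS YE => x <-.
- by move=> x _; rewrite le_max lexx.
Qed.

Lemma le_norm_expect X : intg X -> `|expect X| <= expect (fun x => `|X x|).
Proof. exact: le_normr_Rintegral. Qed.

Lemma integral_expect A X : measurable A -> intg X ->
  (\int[P]_(x in A) (X x)%:E = (expect (fun x => \1_A x * X x))%:E)%E.
Proof.
move=> mA iX; rewrite -expectE; last exact: intgM_indic.
rewrite integral_mkcond; apply: eq_integral => x _.
rewrite /patch indicE; case: (x \in A); by rewrite ?mul1r ?mul0r.
Qed.

Lemma measurable_wrt_preimage G h (Y : set R) : sigma_algebra setT G ->
  measurable_wrt G h -> measurable Y -> G (h @^-1` Y).
Proof.
move=> sG mh mY; have := mh measurableT Y mY; rewrite setTI.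
by rewrite /measurable /= sigma_algebra_id.
Qed.

Lemma measurable_wrt_ge G h (c : R) : sigma_algebra setT G ->
  measurable_wrt G h -> G [set x | c <= h x].
Proof.
move=> sG mh.
have -> : [set x | c <= h x] = h @^-1` `[c, +oo[.
  by apply/seteqP; split => x /=; rewrite in_itv /= andbT.
exact: measurable_wrt_preimage.
Qed.

Lemma measurable_wrt_gt G h (c : R) : sigma_algebra setT G ->
  measurable_wrt G h -> G [set x | c < h x].
Proof.
move=> sG mh.
have -> : [set x | c < h x] = h @^-1` `]c, +oo[.
  by apply/seteqP; split => x /=; rewrite in_itv /= andbT.
exact: measurable_wrt_preimage.
Qed.

Lemma measurable_wrt_le G h (c : R) : sigma_algebra setT G ->
  measurable_wrt G h -> G [set x | h x <= c].
Proof.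
move=> sG mh.
have -> : [set x | h x <= c] = h @^-1` `]-oo, c].
  by apply/seteqP; split => x /=; rewrite in_itv.
exact: measurable_wrt_preimage.
Qed.

Lemma measurable_wrtW G G' h : G `<=` G' -> measurable_wrt G h -> measurable_wrt G' h.
Proof.
move=> GG' mh _ Y mY; apply: sub_sigma_algebra2 GG' _ _.
exact: (mh measurableT Y mY).
Qed.

Lemma measurable_wrt_measurable G h : sigma_algebra setT G ->
  G `<=` measurable -> measurable_wrt G h -> measurable_fun setT h.
Proof.
move=> sG Gm mh _ Y mY; rewrite setTI; apply: Gm.
exact: measurable_wrt_preimage.
Qed.

(** The sum counts the positive integers up to [y], so it is the integer part of [y]. *)
Lemma staircase (y : R) n : 0 <= y <= n%:R ->
  y - 1 <= \sum_(j < n) ((j.+1%:R <= y)%R)%:R <= y.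
Proof.
move=> /andP[y0 yn]; apply/andP; split; last first.
  elim: n {yn} => [|n IH]; first by rewrite big_ord0.
  rewrite big_ord_recr /=; case: (leP n.+1%:R y) => h; last by rewrite /= mulr0n addr0.
  apply: le_trans h; rewrite /= -[in leRHS]natr1 lerD//.
  apply: (@le_trans _ _ (\sum_(j < n) 1)); last by rewrite sumr_const card_ord.
  by apply: ler_sum => j _; case: (_ <= y)%R; rewrite ?ler01.
have full m : m%:R <= y -> \sum_(j < m) ((j.+1%:R <= y)%R)%:R = m%:R :> R.
  move=> my; rewrite -[in RHS](card_ord m) -sumr_const; apply: eq_bigr => j _.
  by rewrite (le_trans _ my)// ler_nat.
elim: n yn => [|n IH] yn; first by rewrite big_ord0; lra.
rewrite big_ord_recr /=; have [h|h] := leP y n%:R.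
  by apply: le_trans (IH h) _; rewrite lerDl.
rewrite full; last exact: ltW.
by apply: (@le_trans _ _ n%:R); rewrite ?lerDl// lerBlDr natr1.
Qed.

Section orthogonality.
Variables (G : set (set T)) (sG : sigma_algebra setT G) (Gm : G `<=` measurable).
Variable X : T -> R.
Hypotheses (iX : intg X) (X0 : forall A, G A -> expect (fun x => \1_A x * X x) = 0).

(* [h] is uniformly within [1/n] of the average of the indicators of
   [{h >= j/n}], [1 <= j <= n], and these sets belong to [G]. *)
Let orthogonal_unit h : measurable_wrt G h -> (forall x, 0 <= h x <= 1) ->
  expect (fun x => h x * X x) = 0.
Proof.
move=> mh h01; apply/eqP; rewrite -normr_le0; apply/ler_addgt0Pr => e e0.
rewrite add0r; have mh' := measurable_wrt_measurable sG Gm mh.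
(* Large enough that the mean of [|X|] divided by [n] is at most [e]. *)
pose n := (Num.truncn (expect (fun x => `|X x|) / e)).+1.
have n0 : 0 < n%:R :> R by rewrite ltr0n.
pose A (j : nat) : set T := [set x | j.+1%:R / n%:R <= h x].
have GA j : G (A j) by exact: measurable_wrt_ge.
pose hn x : R := n%:R^-1 * \sum_(j < n) \1_(A j) x.
have hnE x : hn x = n%:R^-1 * \sum_(j < n) ((j.+1%:R <= n%:R * h x)%R)%:R.
  congr (_ * _); apply: eq_bigr => j _; rewrite indicE; congr (_%:R).
  have -> : (x \in A j) = (j.+1%:R / n%:R <= h x) by apply/idP/idP; rewrite inE.
  by rewrite ler_pdivrMr// mulrC.
have hhn x : `|h x - hn x| <= n%:R^-1.
  have /andP[h0 h1] := h01 x.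
  have /staircase/andP[l1 l2] : 0 <= n%:R * h x <= n%:R.
    by rewrite mulr_ge0 ?(ltW n0)//= ler_piMr// ltW.
  have -> : h x = n%:R^-1 * (n%:R * h x) by rewrite mulKf// gt_eqF.
  rewrite hnE -mulrBr normrM ger0_norm ?invr_ge0 ?(ltW n0)//.
  by rewrite ler_piMr ?invr_ge0 ?(ltW n0)// ger0_norm ?subr_ge0//; lra.
have ihX : intg (fun x => h x * X x).
  apply: (@intgM_bounded_ae _ _ 1) => //; apply: aeW => x.
  by have /andP[h0 h1] := h01 x; rewrite ger0_norm.
have iA j : intg (fun x => n%:R^-1 * (\1_(A j) x * X x)).
  by apply/intgZ/intgM_indic => //; exact: (Gm (GA j)).
have hnXE x : hn x * X x = \sum_(j < n) n%:R^-1 * (\1_(A j) x * X x).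
  by rewrite /hn -mulrA mulr_suml mulr_sumr.
have ihnX : intg (fun x => hn x * X x).
  by have -> : (fun x => hn x * X x) = _ := funext hnXE; exact: (intg_sum n iA).
have E0 : expect (fun x => hn x * X x) = 0.
  rewrite (eq_expect hnXE) (expect_sum n iA) big1// => j _.
  rewrite expectZ ?X0 ?mulr0//; apply: intgM_indic => //; exact: (Gm (GA j)).
rewrite -[expect _]subr0 -E0 -expectB//.
apply: le_trans (le_norm_expect (intgB ihX ihnX)) _.
apply: (@le_trans _ _ (expect (fun x => n%:R^-1 * `|X x|))).
  apply: le_expect.
  - exact/intg_norm/intgB.
  - exact/intgZ/intg_norm.
  - by apply: aeW => x; rewrite -mulrBl normrM ler_wpM2r.
rewrite expectZ; last exact: intg_norm.
rewrite mulrC ler_pdivrMr// -ler_pdivrMl// mulrC.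
exact/ltW/truncnS_gt.
Qed.

Lemma expect_orthogonal h (c : R) : measurable_wrt G h ->
  {ae P, forall x, `|h x| <= c} -> expect (fun x => h x * X x) = 0.
Proof.
move=> mh hc; have mh' := measurable_wrt_measurable sG Gm mh.
have mX := intg_measurable iX.
pose b := `|c| + 1.
have b0 : 0 < b by rewrite ltr_wpDl.
have cb : c <= b by rewrite (le_trans (ler_norm _))// lerDl.
(* [h] is bounded only almost everywhere. Clipping puts [k] in [0, 1] everywhere, keeps it
   measurable for [G], and preserves [h = 2 * b * k - b] almost everywhere. *)
pose k x := Num.min 1 (Num.max 0 ((h x + b) / (2 * b))).
have mk : measurable_wrt G k.
  apply: measurable_minr; first exact: measurable_cst.
  apply: measurable_maxr; first exact: measurable_cst.
  apply: measurable_funM; last exact: measurable_cst.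
  by apply: measurable_funD => //; exact: measurable_cst.
have k01 x : 0 <= k x <= 1.
  by rewrite /k ge_min lexx /= le_min ler01 le_max lexx.
have kE : {ae P, forall x, h x * X x = (2 * b) * (k x * X x) - b * X x}.
  apply: filterS hc => x hx; have {}hx := le_trans hx cb.
  have hb : 0 <= (h x + b) / (2 * b) <= 1.
    move: hx; rewrite ler_norml => /andP[h1 h2].
    by rewrite divr_ge0 ?mulr_ge0 ?(ltW b0)//=; [rewrite ler_pdivrMr ?mulr_gt0//; lra|lra].
  rewrite /k max_r; last by case/andP: hb.
  rewrite min_r; last by case/andP: hb.
  by field; rewrite gt_eqF.
have mk' := measurable_wrt_measurable sG Gm mk.
have ikX : intg (fun x => k x * X x).
  apply: (@intgM_bounded_ae _ _ 1) => //; apply: aeW => x.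
  by have /andP[h0 h1] := k01 x; rewrite ger0_norm.
rewrite (ae_eq_expect _ _ kE).
- rewrite expectB ?expectZ//; [|exact: intgZ|exact: intgZ].
  rewrite orthogonal_unit// mulr0 sub0r.
  have -> : expect X = 0.
    rewrite -(X0 (_ : G setT)); last by case: sG => _ + _; move/(_ set0); rewrite setD0; apply; case: sG.
    by apply: eq_expect => x; rewrite indicT mul1r.
  by rewrite mulr0 oppr0.
- exact: measurable_funM.
- by apply: measurable_funB; apply: measurable_funM => //; exact: measurable_funM.
Qed.

End orthogonality.
End expectation.

(** * Martingales *)

Section martingale_theory.
Context d (T : measurableType d) (R : realType) (P : probability T R).
Implicit Types (X Y g h : T -> R) (A : set T) (G : set (set T)).

Local Notation intg := (intg P).
Local Notation expect := (expect P).

Lemma sigma_algebra_setI G A B : sigma_algebra setT G -> G A -> G B -> G (A `&` B).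
Proof.
move=> sG GA GB; rewrite -(sigma_algebra_id sG).
by apply: (@measurableI _ (g_sigma_algebraType G)); exact: sub_sigma_algebra.
Qed.

Lemma is_condexpP G g h : G `<=` measurable -> intg g ->
  is_condexp P G g h <->
  [/\ measurable_wrt G h, intg h &
      forall A, G A -> expect (fun x => \1_A x * h x) = expect (fun x => \1_A x * g x)].
Proof.
move=> Gm ig; split => -[mh ih H]; split=> // A GA; have mA := Gm _ GA.
- by have := H A GA; rewrite !integral_expect// => -[].
- by rewrite !integral_expect// H.
Qed.

(** The set where one version exceeds the other belongs to [G]; the positive difference integrates
    to 0 over it, so it is null. *)
Lemma is_condexp_ae_unique G g h h' : sigma_algebra setT G -> G `<=` measurable ->
  is_condexp P G g h -> is_condexp P G g h' -> {ae P, forall x, h x = h' x}.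
Proof.
move=> sG Gm [mh ih Hh] [mh' ih' Hh'].
have half u v : measurable_wrt G u -> intg u -> measurable_wrt G v -> intg v ->
    (forall A, G A -> \int[P]_(x in A) (u x)%:E = \int[P]_(x in A) (v x)%:E)%E ->
    {ae P, forall x, u x <= v x}.
  move=> mu iu mv iv uv.
  pose w x := u x - v x.
  have mw : measurable_wrt G w by exact: measurable_funB.
  pose W : set T := [set x | 0 < w x].
  have GA : G W by exact: measurable_wrt_gt.
  have mA := Gm _ GA; have mw' := measurable_wrt_measurable sG Gm mw.
  have : (\int[P]_(x in W) `|(w x)%:E| = 0)%E.
    transitivity (\int[P]_(x in W) ((u x)%:E - (v x)%:E))%E.
      apply: eq_integral => x; rewrite inE /= => wx.
      by rewrite -EFinB gtr0_norm.
    rewrite integralB_EFin//; [|exact: integrableS iu|exact: integrableS iv].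
    rewrite uv// subee// integrable_fin_num//; exact: integrableS iv.
  move/ae_eq_integral_abs => /(_ mA) H.
  have mwE : measurable_fun W (EFin \o w).
    by apply/measurable_EFinP; apply: measurable_funTS.
  apply: filterS (H mwE) => x /= Hx.
  rewrite leNgt; apply/negP => vu.
  have wx : 0 < w x by rewrite /w subr_gt0.
  by have [] := Hx wx; move: wx => /[swap] ->; rewrite ltxx.
have h1 := half h h' mh ih mh' ih' (fun A GA => etrans (Hh A GA) (esym (Hh' A GA))).
have h2 := half h' h mh' ih' mh ih (fun A GA => etrans (Hh' A GA) (esym (Hh A GA))).
by apply: filterS2 h1 h2 => x h1 h2; apply/eqP; rewrite eq_le h1.
Qed.

Lemma condexp_ae_eq G g h : sigma_algebra setT G -> G `<=` measurable ->
  is_condexp P G g h -> {ae P, forall x, condexp P G g x = h x}.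
Proof.
move=> sG Gm gh; apply: (is_condexp_ae_unique sG Gm) (gh).
exact: (@xgetPex _ (cst 0) [set h | is_condexp P G g h]) (ex_intro _ h gh).
Qed.

Variables (Sig : nat -> set (set T)) (HSig : filtration Sig).

Let sS n : sigma_algebra setT (Sig n). Proof. by case: HSig. Qed.
Let Sm n : Sig n `<=` measurable. Proof. by case: HSig. Qed.
Let S_le m n : (m <= n)%N -> Sig m `<=` Sig n. Proof. by case: HSig => _ _ + _; apply. Qed.

Lemma martingaleP (M : nat -> T -> R) : martingale P Sig M <->
  [/\ forall n, intg (M n), forall n, measurable_wrt (Sig n) (M n) &
    forall n A, Sig n A ->
      expect (fun x => \1_A x * M n.+1 x) = expect (fun x => \1_A x * M n x)].
Proof.
split=> [[iM cM]|[iM mM sM]].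
  split=> // [n|n A nA]; first by have [] := cM n n (leqnn n).
  by have /(is_condexpP _ (@Sm n) (iM n.+1)) [_ _ ->] := cM n.+1 n (leqnSn n).
split=> // m n nm; apply/is_condexpP => //; split => // A nA.
elim: m nm => [|m IH]; first by rewrite leqn0 => /eqP ->.
rewrite leq_eqVlt => /predU1P[->//|]; rewrite ltnS => nm.
by rewrite (IH nm) sM//; exact: S_le nA.
Qed.

Lemma martingaleB (M N : nat -> T -> R) : martingale P Sig M -> martingale P Sig N ->
  martingale P Sig (fun n x => M n x - N n x).
Proof.
move=> /martingaleP[iM mM sM] /martingaleP[iN mN sN]; apply/martingaleP; split.
- by move=> n; exact: intgB.
- by move=> n; exact: measurable_funB (mM n) (mN n).
- move=> n A nA; have mA := Sm nA.
  under eq_expect do rewrite mulrBr.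
  under [RHS]eq_expect do rewrite mulrBr.
  by rewrite !expectB ?sM ?sN//; exact: intgM_indic.
Qed.

Lemma martingaleZ (r : R) (M : nat -> T -> R) : martingale P Sig M ->
  martingale P Sig (fun n x => r * M n x).
Proof.
move=> /martingaleP[iM mM sM]; apply/martingaleP; split.
- by move=> n; exact: intgZ.
- by move=> n; apply: measurable_funM (mM n); exact: measurable_cst.
- move=> n A nA; have mA := Sm nA.
  under eq_expect do rewrite mulrCA.
  under [RHS]eq_expect do rewrite mulrCA.
  by rewrite !expectZ ?sM//; exact: intgM_indic.
Qed.

(** A transform by predictable indicators: the event [L n.+1 <= c] lies in [Sig n], so cutting a set
    of [Sig n] with it stays in [Sig n], over which the next increment integrates to 0. At index 0,
    where [0.-1 = 0], measurability for [Sig 0] is enough. *)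
Lemma martingale_stopped (L : nat -> T -> R) (c : R) (f : nat -> T -> R) :
  (forall n, measurable_wrt (Sig n.-1) (L n)) -> martingale P Sig f ->
  martingale P Sig (fun n x => stopped (L^~ x) c (f^~ x) n).
Proof.
move=> mL /martingaleP[iM mM sM]; apply/martingaleP.
pose A i : set T := [set x | L i x <= c].
have GA i : Sig i.-1 (A i) by exact: measurable_wrt_le.
have GA' i : Sig i (A i) by apply: S_le (GA i); exact: leq_pred.
pose D i x := \1_(A i) x * seq_diff (f^~ x) i.
have sDx n x : stopped (L^~ x) c (f^~ x) n = \sum_(i < n.+1) D i x.
  apply: eq_bigr => i _; rewrite /D indicE.
  have -> : (x \in A i) = (L i x <= c) by apply/idP/idP; rewrite inE.
  by case: ifP => _; rewrite ?mul1r ?mul0r.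
have sD n := funext (sDx n).
have id_ i : intg (fun x => seq_diff (f^~ x) i) by case: i => [|i] //=; exact: intgB.
have md i : measurable_wrt (Sig i) (fun x => seq_diff (f^~ x) i).
  case: i => [|i] /=; first exact: mM.
  exact: measurable_funB (mM i.+1) (measurable_wrtW (S_le (leqnSn i)) (mM i)).
have iD i : intg (D i) by apply: intgM_indic => //; exact: Sm (GA' i).
have mD i : measurable_wrt (Sig i) (D i).
  apply: (measurable_funM _ (md i)).
  by apply: (@measurable_indic _ (g_sigma_algebraType (Sig i))); exact: sub_sigma_algebra (GA' i).
split.
- by move=> n; rewrite sD; exact: (intg_sum n.+1 iD).
- move=> n; rewrite sD; apply: measurable_sum => i.
  by apply: measurable_wrtW (mD i); apply: S_le; rewrite -ltnS.
- move=> n B nB; have mB := Sm nB.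
  have isum : intg (fun x => \sum_(i < n.+1) D i x) by exact: (intg_sum n.+1 iD).
  under eq_expect do rewrite sDx big_ord_recr /= mulrDr.
  under [RHS]eq_expect do rewrite sDx.
  rewrite expectD; [|exact: intgM_indic|exact: intgM_indic].
  rewrite -[RHS]addr0; congr (_ + _).
  have BA : Sig n (B `&` A n.+1) by exact: sigma_algebra_setI (sS n) nB (GA n.+1).
  rewrite (@eq_expect _ _ _ _ _ (fun x => \1_(B `&` A n.+1) x * f n.+1 x
      - \1_(B `&` A n.+1) x * f n x)); last first.
    by move=> x; rewrite /D indicI /=; ring.
  have mBA := Sm BA.
  rewrite expectB ?sM ?subrr//; exact: intgM_indic.
Qed.

(** * Orthogonal increments and closure of L^2-bounded martingales *)

Section square_integrable.
Variables (M : nat -> T -> R) (K : nat -> R).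
Hypotheses (HM : martingale P Sig M)
  (MK : forall n, {ae P, forall x, `|M n x| <= K n}).

Let iM n : intg (M n). Proof. by have [/(_ n)] := HM. Qed.
Let mM n : measurable_wrt (Sig n) (M n).
Proof. by have /martingaleP[_ + _] := HM. Qed.

Let iMM m n : intg (fun x => M m x * M n x).
Proof.
apply: (intgM_bounded_ae _ (iM n) (MK m)).
exact: measurable_wrt_measurable (@Sm m) _.
Qed.

(** The cross term [M n * (M m - M n)] has mean 0: the increment is orthogonal to bounded functions
    known at time [n]. *)
Lemma expect_increment_sq m n : (n <= m)%N ->
  expect (fun x => (M m x - M n x) ^+ 2) =
  expect (fun x => M m x ^+ 2) - expect (fun x => M n x ^+ 2).
Proof.
move=> nm.
have X0 A : Sig n A -> expect (fun x => \1_A x * (M m x - M n x)) = 0.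
  move=> nA; have mA := Sm nA.
  under eq_expect do rewrite mulrBr.
  rewrite expectB; [|exact: intgM_indic|exact: intgM_indic].
  case: HM => _ /(_ m n nm) /(is_condexpP _ (@Sm n) (iM m))[_ _ ->//].
  by rewrite subrr.
have orth := expect_orthogonal (sS n) (@Sm n) (intgB (iM m) (iM n)) X0 (@mM n) (MK n).
have iX : intg (fun x => M n x * (M m x - M n x)).
  have -> : (fun x => M n x * (M m x - M n x)) =
    (fun x => M n x * M m x - M n x * M n x) by apply/funext => x; ring.
  exact: intgB.
rewrite (@eq_expect _ _ _ _ _ (fun x => (M m x * M m x - M n x * M n x)
   - 2 * (M n x * (M m x - M n x)))); last by move=> x; ring.
rewrite expectB ?expectZ ?orth//; [|exact: intgB|exact: intgZ].
by rewrite mulr0 subr0 expectB.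
Qed.

Let intg_diff_sq m n : intg (fun x => (M m x - M n x) ^+ 2).
Proof.
have -> : (fun x => (M m x - M n x) ^+ 2) =
    (fun x => (M m x * M m x - M m x * M n x) - (M m x * M n x - M n x * M n x)).
  by apply/funext => x; ring.
by apply: intgB; exact: intgB.
Qed.

Lemma intg_sq n : intg (fun x => M n x ^+ 2).
Proof. exact: iMM. Qed.

Lemma intg_increment_sq i : intg (fun x => `|seq_diff (M^~ x) i| ^+ 2).
Proof.
case: i => [|i] /=; under [X in intg X]eq_fun do rewrite real_normK ?num_real//.
  exact: intg_sq.
exact: intg_diff_sq.
Qed.

(** This is what turns a bound on the square function into a bound in L^2; the increments being
    orthogonal, the second moments telescope. *)
Lemma expect_sum_sq n : expect (fun x => \sum_(i < n.+1) `|seq_diff (M^~ x) i| ^+ 2) =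
  expect (fun x => M n x ^+ 2).
Proof.
have idd i := @intg_increment_sq i.
elim: n => [|n IH].
  by apply: eq_expect => x; rewrite big_ord1 /= real_normK ?num_real.
under eq_expect do rewrite big_ord_recr /=.
rewrite expectD; [|exact: (intg_sum n.+1 idd)|exact: (idd n.+1)].
rewrite IH; under [X in _ + X]eq_expect do rewrite real_normK ?num_real//.
by rewrite expect_increment_sq// addrC subrK.
Qed.

(** The second moments increase to a finite limit, and their differences are the second moments of
    the increments: late enough, these are at most [4^(-k)], which controls first moments by
    [2^(-k)]. *)
Let subsequence (B : R) : (forall n, expect (fun x => M n x ^+ 2) <= B) ->
  exists nk : nat -> nat, [/\ forall k, (k <= nk k)%N,
    forall k, (nk k <= nk k.+1)%N &
    forall k, expect (fun x => `|M (nk k.+1) x - M (nk k) x|) <= (2^-1) ^+ k].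
Proof.
move=> MB; pose e n := expect (fun x => M n x ^+ 2).
have end_ : nondecreasing_seq e.
  apply/nondecreasing_seqP => n; rewrite -subr_ge0 /e -expect_increment_sq//.
  by apply: Rintegral_ge0 => x _; exact: sqr_ge0.
have ecvg : cvgn e.
  apply: nondecreasing_is_cvgn => //; exists B => _ [n _ <-]; exact: MB.
have ele n : e n <= limn e by exact: nondecreasing_cvgn_le.
have /choice[N HN] : forall k, exists n, limn e - e n <= (4^-1) ^+ k.
  move=> k; have k0 : 0 < (4^-1) ^+ k :> R by rewrite exprn_gt0// invr_gt0.
  move/cvgrPdist_le : ecvg => /(_ _ k0)[n _ Hn]; exists n.
  by have := Hn n (leqnn n); rewrite ger0_norm// subr_ge0.
(* Summing the thresholds gives a nondecreasing sequence above [N k]; adding [k] makes it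
   unbounded. *)
pose nk k := (k + \sum_(j < k.+1) N j)%N.
have nkN k : (N k <= nk k)%N by rewrite /nk big_ord_recr /=; lia.
have nkS k : (nk k <= nk k.+1)%N by rewrite /nk [in leqRHS]big_ord_recr /=; lia.
exists nk; split=> // [k|k]; first exact: leq_addr.
have iD : intg (fun x => M (nk k.+1) x - M (nk k) x) by exact: intgB.
have i2 := intg_diff_sq (nk k.+1) (nk k).
pose t : R := 2 ^+ k; have t0 : 0 < t by rewrite exprn_gt0.
have tV : (2^-1) ^+ k = t^-1 :> R by rewrite exprVn.
have tV2 : (4^-1) ^+ k = t^-1 * t^-1 :> R.
  by rewrite -tV -exprMn -invfM; congr ((_^-1) ^+ _); ring.
(* The weight [t = 2^k] balances the two terms: each contributes at most [2^(-k) / 2]. *)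
apply: (@le_trans _ _ (expect (fun x => t / 2 * (M (nk k.+1) x - M (nk k) x) ^+ 2
    + t^-1 / 2))).
  apply: le_expect; first exact: intg_norm.
    by apply: intgD; [exact: intgZ|exact: intg_cst].
  apply: aeW => x; set D := _ - _; rewrite -[D ^+ 2]real_normK ?num_real//.
  (* AM-GM: [2 t |D| <= t^2 |D|^2 + 1] *)
  have : 0 <= t^-1 / 2 * (t * `|D| - 1) ^+ 2.
    by rewrite mulr_ge0 ?sqr_ge0 ?divr_ge0 ?invr_ge0 ?(ltW t0).
  have -> : t^-1 / 2 * (t * `|D| - 1) ^+ 2 = t / 2 * `|D| ^+ 2 + t^-1 / 2 - `|D|.
    by field; rewrite gt_eqF.
  by rewrite subr_ge0.
rewrite expectD; [|exact: (intgZ _ i2)|exact: intg_cst].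
rewrite expectZ// expect_cst.
rewrite expect_increment_sq// tV.
have : e (nk k.+1) - e (nk k) <= t^-1 * t^-1.
  rewrite -tV2; apply: le_trans (HN k); apply: lerB; first exact: ele.
  exact: end_.
rewrite /e; move: (_ - _) => D h.
have th0 : 0 <= t / 2 by rewrite divr_ge0 ?(ltW t0).
have := ler_wpM2l th0 h.
have -> : t / 2 * (t^-1 * t^-1) = t^-1 / 2 by field; rewrite gt_eqF.
lra.
Qed.

(* By orthogonality of increments a subsequence converges fast in L^1, hence
   almost everywhere and dominated by an integrable function. *)
Lemma L2_bounded_martingale_closed (B : R) :
  (forall n, expect (fun x => M n x ^+ 2) <= B) ->
  exists2 a : T -> R, intg a & forall n, is_condexp P (Sig n) a (M n).
Proof.
move=> /subsequence[nk [nk_ge nk_nd nkE]].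
have mM' n : measurable_fun setT (M n) by exact: intg_measurable (iM n).
pose D k x := `|M (nk k.+1) x - M (nk k) x|.
have iD k : intg (D k) by apply/intg_norm/intgB.
have D0 k x : (0 <= (D k x)%:E)%E by rewrite lee_fin normr_ge0.
(* By telescoping [H] dominates every [M (nk k)], and it is integrable because the means of the
   jumps decrease geometrically. *)
pose H x : \bar R := (`|M (nk 0%N) x|%:E + \sum_(k <oo) (D k x)%:E)%E.
have mDs : measurable_fun setT (fun x => \sum_(k <oo) (D k x)%:E)%E.
  apply: ge0_emeasurable_sum => [k x _ _|k _]; first exact: D0.
  by apply/measurable_EFinP; exact: intg_measurable (iD k).
have mH : measurable_fun setT H.
  by apply: emeasurable_funD => //; apply/measurable_EFinP; exact: measurableT_comp.
have H0 x : (0 <= H x)%E by rewrite adde_ge0// nneseries_ge0.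
have iH : P.-integrable setT H.
  apply/integrableP; split => //.
  under eq_integral do rewrite gee0_abs//.
  rewrite ge0_integralD//; first last.
  - by move=> x _; apply: nneseries_ge0 => k _ _; exact: D0.
  - by apply/measurable_EFinP; exact: measurableT_comp.
  rewrite (expectE (intg_norm (iM _))) lte_add_pinfty ?ltry//.
  rewrite integral_nneseries//; last first.
    by move=> k; apply/measurable_EFinP; exact: intg_measurable (iD k).
  apply: (@le_lt_trans _ _ (\sum_(k <oo) ((2^-1) ^+ k)%:E)%E).
    apply: lee_nneseries => [k _|k _]; last by rewrite (expectE (iD k)) lee_fin nkE.
    by move=> _; apply: integral_ge0 => x _; exact: D0.
  have -> : (fun n => \sum_(0 <= k < n) ((2^-1 : R) ^+ k)%:E)%E =
            EFin \o series (geometric 1 (2^-1)).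
    by apply/funext => n; rewrite /= sumEFin /series /=; under [in RHS]eq_bigr do rewrite mul1r.
  have /cvg_lim -> // : (EFin \o series (geometric 1 (2^-1 : R))) @ \oo --> ((1 - 2^-1)^-1 : R)%:E.
    apply/fine_cvgP; split; first exact: nearW.
    have := @cvg_geometric_series R 1 (2^-1); rewrite mul1r; apply.
    by rewrite ger0_norm ?invr_ge0// invf_lt1 ?ltr1n.
  exact: ltry.
have MH k x : (`|(M (nk k) x)%:E| <= H x)%E.
  apply: (@le_trans _ _ (`|M (nk 0%N) x|%:E + \sum_(0 <= j < k) (D j x)%:E)%E); last first.
    by rewrite leeD2l//; apply: nneseries_lim_ge.
  rewrite sumEFin -EFinD lee_fin; elim: k => [|k IH].
    by rewrite big_nil addr0.
  rewrite big_nat_recr//= addrA.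
  have := ler_normD (M (nk k.+1) x - M (nk k) x) (M (nk k) x).
  rewrite subrK -/(D k x); move: IH; lra.
(* The upper limit is defined and measurable everywhere, and is the limit wherever the sequence
   converges. *)
pose f x := limn_esup (fun k => (M (nk k) x)%:E).
have mf : measurable_fun setT f.
  by apply: measurable_fun_limn_esup => k; exact/measurable_EFinP.
have cvgf : {ae P, forall x, (fun k => (M (nk k) x)%:E) @ \oo --> f x}.
  apply: filterS (integrable_ae measurableT iH) => x /(_ I) Hfin.
  have sfin : (\sum_(k <oo) (D k x)%:E)%E \is a fin_num.
    rewrite ge0_fin_numE ?nneseries_ge0//.
    move: Hfin; rewrite ge0_fin_numE//; apply: le_lt_trans.
    by rewrite leeDr.
  have : cvgn [normed series (telescope (fun k => M (nk k) x))].
    apply: (nondecreasing_is_cvgn (u_ := [normed series (telescope (fun k => M (nk k) x))])).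
      by apply: nondecreasing_series => k _ _; exact: normr_ge0.
    exists (fine (\sum_(k <oo) (D k x)%:E)%E) => _ [n _ <-].
    rewrite -lee_fin fineK//.
    have -> : ([normed series (telescope (fun k => M (nk k) x))] n)%:E
       = (\sum_(0 <= k < n) (D k x)%:E)%E by rewrite sumEFin.
    exact: nneseries_lim_ge.
  move/normed_cvg/cvg_ex => [l /= Hl].
  have Hc : (fun k => M (nk k) x) @ \oo --> l + M (nk 0%N) x.
    rewrite [X in X @ _ --> _](_ : _ =
      (fun k => series (telescope (fun k => M (nk k) x)) k + M (nk 0%N) x)); last first.
      by apply/funext => k; rewrite seriesEnat /= telescope_sumr// subrK.
    by apply: cvgD => //; exact: cvg_cst.
  have Hc' : (fun k => (M (nk k) x)%:E) @ \oo --> (l + M (nk 0%N) x)%:E.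
    by apply/fine_cvgP; split; [exact: nearW|exact: Hc].
  by rewrite /f (cvg_limn_einf_sup Hc').2.
have domA A : measurable A ->
    P.-integrable A f /\ (\int[P]_(x in A) (M (nk k) x)%:E)%E @[k --> \oo] -->
      (\int[P]_(x in A) f x)%E.
  move=> mA.
  have [] := @dominated_convergence _ _ _ P A mA (fun k x => (M (nk k) x)%:E) f H.
  - by move=> k; apply/measurable_EFinP; exact: measurable_funTS.
  - exact: measurable_funTS.
  - by apply: filterS cvgf => x + _.
  - exact: integrableS iH.
  - by apply: aeW => x k _; exact: MH.
  by [].
have [if_ _] := domA _ measurableT.
pose a x := fine (f x).
have ma : measurable_fun setT a by apply: (measurableT_comp _ mf); exact: fine_measurable.
have fa : {ae P, forall x, f x = (a x)%:E}.
  by apply: filterS (integrable_ae measurableT if_) => x /(_ I) fx; rewrite /a fineK.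
have ia : intg a.
  apply/integrableP; split; first exact/measurable_EFinP.
  move/integrableP: if_ => [_]; apply: le_lt_trans.
  apply: ae_ge0_le_integral => //.
  - by apply: measurableT_comp => //; exact/measurable_EFinP.
  - exact: measurableT_comp.
  - by apply: filterS fa => x ->.
exists a => // n; split; [exact: mM|exact: iM|move=> A nA].
have mA := Sm nA; have [_ cA] := domA A mA.
have -> : (\int[P]_(x in A) (a x)%:E = \int[P]_(x in A) f x)%E.
  apply: ae_eq_integral => //.
  - by apply/measurable_EFinP; exact: measurable_funTS.
  - exact: measurable_funTS.
  - by apply: filterS fa => x ->.
apply/esym/(cvg_unique _ cA) => //=.
(* Once [nk k >= n], the integral of [M (nk k)] over [A] equals that of [M n], so the converging
   sequence is eventually constant. *)
apply: cvg_near_cst; exists n => // k /= nk'.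
have nnk : (n <= nk k)%N := leq_trans nk' (nk_ge k).
by case: HM => _ /(_ _ _ nnk)[_ _ ->].
Qed.

End square_integrable.
End martingale_theory.

(** * Vanishing of the tails *)

Section luxemburg_limits.
Context d (T : measurableType d) (R : realType) (P : probability T R).
Variables (p : T -> R) (Hp : variable_exponent P p).

Let pm := exponent_minus P p.
Let pp := exponent_plus P p.
Let pm0 : 0 < pm := exponent_minus_gt0 Hp.
Let pp0 : 0 < pp := exponent_plus_gt0 Hp.
Let p_gt0 x : 0 < p x. Proof. by case: Hp => _ + _ _; apply. Qed.

(** The modular at scale 1 is then 0, by [modular_le_pow] with [b = 0]. *)
Lemma luxnorm_le0_ae (w : T -> R) : measurable_fun setT w ->
  (forall x, 0 <= w x) -> (luxnorm P p (EFin \o w) <= 0)%E ->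
  {ae P, forall x, w x = 0}.
Proof.
move=> mw w0 hw.
have := modular_le_pow Hp mw w0 (lexx _) ltr01 hw.
rewrite mul0r powR0 ?gt_eqF// => h.
have mf : measurable_fun setT (fun x => ((w x / 1) `^ p x)%:E).
  by apply/measurable_EFinP; apply: (measurable_powR_var Hp); exact: measurable_funM.
have : (\int[P]_x `|((w x / 1) `^ p x)%:E| = 0)%E.
  apply/eqP; rewrite eq_le integral_ge0// andbT.
  by under eq_integral do rewrite gee0_abs ?lee_fin ?powR_ge0//.
move/(ae_eq_integral_abs _ measurableT mf); apply: filterS => x /(_ I)[].
by rewrite divr1 => /powR_eq0_eq0.
Qed.

(* Dominates the limit of the controlling sequence of the remainder
   [f - sum_(-N <= k <= N) theta_k a^k] when [G = lambda_oo]. *)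
Definition tail (G : T -> R) (N : nat) (x : T) : R :=
  Num.min (G x) (2 ^- N) + (if 2 ^+ N < G x then 2 * G x else 0).

Lemma measurable_tail (G : T -> R) N : measurable_fun setT G ->
  measurable_fun setT (tail G N).
Proof.
move=> mG; apply: measurable_funD.
  by apply: measurable_minr => //; exact: measurable_cst.
apply: measurable_fun_ifT.
- by apply: measurable_fun_ltr => //; exact: measurable_cst.
- by apply: measurable_funM => //; exact: measurable_cst.
- exact: measurable_cst.
Qed.

Lemma tail_ge0 (G : T -> R) N x : 0 <= G x -> 0 <= tail G N x.
Proof.
move=> G0; rewrite addr_ge0//; first by rewrite le_min G0 invr_ge0 exprn_ge0.
by case: ifP => // _; rewrite mulr_ge0.
Qed.

Lemma tail_le (G : T -> R) N x : 0 <= G x -> tail G N x <= 3 * G x.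
Proof.
move=> G0; have : Num.min (G x) (2 ^- N) <= G x by rewrite ge_min lexx.
by rewrite /tail; case: ifP => _; lra.
Qed.

Lemma tail_small (G : T -> R) x (e : R) : 0 < e ->
  exists N, forall n, (N <= n)%N -> tail G n x <= e.
Proof.
move=> e0; have [N1 h1] := two_expr_gt (G x); have [N2 h2] := two_expr_gt e^-1.
exists (maxn N1 N2) => n; rewrite geq_max => /andP[n1 n2].
rewrite /tail ltNge (ltW (h1 n n1)) addr0 ge_min; apply/orP; right.
by rewrite -(invrK e) lef_pV2 ?posrE ?exprn_gt0 ?invr_gt0// ltW// h2.
Qed.

(** Dominated convergence is applied to the modular at the fixed scale [e]; a value at most 1 there
    is all that is needed. *)
Lemma luxnorm_tail_small (G : T -> R) (e : R) : measurable_fun setT G ->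
  (forall x, 0 <= G x) -> (luxnorm P p (EFin \o G) < +oo)%E -> 0 < e ->
  exists N, (luxnorm P p (EFin \o tail G N) <= e%:E)%E.
Proof.
move=> mG G0 Gfin e0.
have [s s0 hs] : exists2 s : R, 0 < s & (\int[P]_x ((G x / s) `^ p x)%:E <= 1)%E.
  have Gr : (luxnorm P p (EFin \o G))%E \is a fin_num by rewrite ge0_fin_numE ?luxnorm_ge0.
  exists (fine (luxnorm P p (EFin \o G)) + 1); first by rewrite ltr_wpDl// fine_ge0// luxnorm_ge0.
  apply: (luxnorm_EFin_lt Hp mG G0); first by rewrite ltr_wpDl// fine_ge0// luxnorm_ge0.
  by rewrite -[X in (X < _)%E](fineK Gr) lte_fin ltrDl.
(* Chosen so that [3 * G / e <= b * G / s], with [tail_le] giving the 3; the summand 1 ensures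
   [b >= 1], hence [b^(p x) <= b^(p^+)]. *)
pose b : R := 1 + 3 * s / e.
have b1 : 1 <= b by rewrite lerDl divr_ge0 ?mulr_ge0 ?ltW.
have b0 : 0 < b := lt_le_trans ltr01 b1.
have mt N : measurable_fun setT (fun x => ((tail G N x / e) `^ p x)%:E).
  apply/measurable_EFinP; apply: (measurable_powR_var Hp).
  by apply: measurable_funM => //; exact: measurable_tail.
pose g x : \bar R := ((b `^ pp)%:E * ((G x / s) `^ p x)%:E)%E.
have mGs : measurable_fun setT (fun x => ((G x / s) `^ p x)%:E).
  by apply/measurable_EFinP; apply: (measurable_powR_var Hp); exact: measurable_funM.
have ig : P.-integrable setT g.
  apply: integrableZl => //; apply/integrableP; split => //.
  under eq_integral do rewrite gee0_abs ?lee_fin ?powR_ge0//.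
  by apply: le_lt_trans hs _; rewrite ltry.
have dom : {ae P, forall x, forall N : nat, setT x ->
    (`|((tail G N x / e) `^ p x)%:E| <= g x)%E}.
  apply: filterS (ae_exponent_bounds Hp) => x /andP[_ ppx] N _.
  rewrite gee0_abs; last by rewrite lee_fin powR_ge0.
  rewrite /g -EFinM lee_fin.
  apply: (@le_trans _ _ (b `^ p x * (G x / s) `^ p x)).
    rewrite -powRM ?(ltW b0) ?divr_ge0 ?(ltW s0)//.
    apply: powR_homo; [exact: ltW|by rewrite divr_ge0 ?tail_ge0// ltW|].
    rewrite ler_pdivrMr//.
    have -> : b * (G x / s) * e = 3 * G x + e / s * G x.
      by rewrite /b; field; rewrite !gt_eqF.
    apply: le_trans (tail_le N (G0 x)) _.
    by rewrite lerDl mulr_ge0// divr_ge0// ltW.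
  by rewrite ler_wpM2r ?powR_ge0// ler_powR.
have cv : {ae P, forall x, setT x ->
    (fun N => ((tail G N x / e) `^ p x)%:E) @ \oo --> cst 0%E x}.
  apply: aeW => x _; apply/fine_cvgP; split; first exact: nearW.
  apply/cvgrPdist_le => /= r r0.
  have er0 : 0 < e * r `^ (p x)^-1 by rewrite mulr_gt0 ?powR_gt0.
  have [N HN] := tail_small G x er0; exists N => // n /= Nn.
  rewrite sub0r normrN ger0_norm ?powR_ge0//.
  apply: powR_leV; rewrite ?divr_ge0 ?tail_ge0 ?(ltW e0) ?(ltW r0)//.
  by rewrite ler_pdivrMr// mulrC HN.
have [_ _] := dominated_convergence measurableT mt (measurable_cst 0%E) cv ig dom.
rewrite integral0 => /fine_cvgP[Hfin /cvgrPdist_le /(_ 1 ltr01)].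
move=> /(filterI Hfin)[N _ /(_ N (leqnn N))] /= [fN].
rewrite sub0r normrN ger0_norm => [h|]; last first.
  by rewrite fine_ge0// integral_ge0// => x _; rewrite lee_fin powR_ge0.
exists N; apply: (luxnorm_EFin_le (fun x => tail_ge0 N (G0 x)) e0).
by rewrite -(fineK fN) lee_fin.
Qed.

End luxemburg_limits.

(** * Predictable controlling sequences *)

Section predictable_sequences.
Context d (T : measurableType d) (R : realType).
Variables (Sig : nat -> set (set T)) (HSig : filtration Sig).
Implicit Types (lam : int -> T -> R) (c : R).

Let sS n : sigma_algebra setT (Sig n). Proof. by case: HSig. Qed.
Let Sm n : Sig n `<=` measurable. Proof. by case: HSig. Qed.
Let S_le m n : (m <= n)%N -> Sig m `<=` Sig n. Proof. by case: HSig => _ _ + _; apply. Qed.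

(* [shifted lam n] is [lambda_(n-1)], so that [n] ranges over [nat]. *)
Definition shifted lam (n : nat) : T -> R := lam (n%:Z - 1).

Lemma sigma_algebra_filtration_ext k : sigma_algebra setT (filtration_ext Sig k).
Proof.
case: k => [n|n] /=; first exact: sS.
split.
- by left.
- by move=> A [->|->]; [right; rewrite setD0|left; rewrite setDv].
- move=> F HF; have [[i Fi]|noF] := pselect (exists i, F i = setT).
    by right; apply/seteqP; split => // x _; exists i => //; rewrite Fi.
  left; apply/seteqP; split => // x [i _]; case: (HF i) => [->//|Fi].
  by case: noF; exists i.
Qed.

Section lambda.
Variables (lam : int -> T -> R) (Hlam : Lambda Sig lam).
Let L := shifted lam.

Lemma shiftedS n : L n.+1 = lam n%:Z.
Proof. by rewrite /L /shifted; congr lam; lia. Qed.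

Lemma shifted_ge0 n x : 0 <= L n x.
Proof. by have [|_ + _] := Hlam (_ : -1 <= n%:Z - 1); [lia|apply]. Qed.

Lemma shifted_nd n x : L n x <= L n.+1 x.
Proof.
have [|_ _ /(_ x)] := Hlam (_ : -1 <= n%:Z - 1); first by lia.
by rewrite subrK shiftedS.
Qed.

Lemma measurable_wrt_shifted n : measurable_wrt (Sig n.-1) (L n).
Proof.
case: n => [|n] /=; last by rewrite shiftedS; have [] := Hlam (_ : -1 <= n%:Z).
have [//|m0 _ _] := Hlam (_ : -1 <= 0%:Z - 1).
apply: measurable_wrtW m0 => A [->|->]; first by case: (sS 0).
by case: (sS 0) => _ + _; move/(_ set0); rewrite setD0; apply; case: (sS 0).
Qed.

Lemma measurable_shifted n : measurable_fun setT (L n).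
Proof. exact: measurable_wrt_measurable (sS n.-1) (@Sm n.-1) (@measurable_wrt_shifted n). Qed.

Let cvg_oo x : (lam n%:Z x)%:E @[n --> \oo] --> lambda_oo lam x.
Proof.
apply: ereal_nondecreasing_is_cvgn; apply/nondecreasing_seqP => n.
by rewrite lee_fin -!shiftedS shifted_nd.
Qed.

Lemma shifted_le_oo n x : ((L n x)%:E <= lambda_oo lam x)%E.
Proof.
apply: (@le_trans _ _ (L n.+1 x)%:E); first by rewrite lee_fin shifted_nd.
rewrite shiftedS /lambda_oo; apply: lime_ge; first by apply/cvg_ex; exists (lambda_oo lam x); exact: cvg_oo.
exists n => // m /= nm; rewrite lee_fin -!shiftedS.
have /nondecreasing_seqP h := fun k => shifted_nd k x.
by apply: h; rewrite ltnS.
Qed.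

Lemma lambda_oo_le (y : \bar R) x : (forall n, ((L n x)%:E <= y)%E) ->
  (lambda_oo lam x <= y)%E.
Proof.
move=> h; apply: lime_le; first by apply/cvg_ex; exists (lambda_oo lam x); exact: cvg_oo.
by apply: nearW => n; rewrite -shiftedS.
Qed.

Lemma lambda_oo_ge0 x : (0 <= lambda_oo lam x)%E.
Proof. by apply: le_trans (shifted_le_oo 0 x); rewrite lee_fin shifted_ge0. Qed.

Lemma measurable_lambda_oo : measurable_fun setT (lambda_oo lam).
Proof.
apply: (emeasurable_fun_cvg (fun n x => (lam n%:Z x)%:E)) => [n|x _]; last exact: cvg_oo.
by apply/measurable_EFinP; rewrite -shiftedS; exact: measurable_shifted.
Qed.

(** The least [n] with [c < lambda_(n-1)] is lowered by one, giving the first index, possibly -1, at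
    which [lambda] exceeds [c]. *)
Definition hitting_time c x : \bar int :=
  if pselect (exists n, c < L n x) is left H then ((ex_minn H)%:Z - 1)%:E else +oo%E.

Lemma hitting_time_le c n x : (hitting_time c x <= (n%:Z - 1)%:E)%E = (c < L n x).
Proof.
rewrite /hitting_time; case: pselect => [H|H]; last first.
  by rewrite leye_eq; apply/esym/negbTE/negP => h; apply: H; exists n.
case: ex_minnP => m cm min_m; rewrite lee_fin lerD2r lez_nat.
apply/idP/idP => [mn|]; last exact: min_m.
apply: lt_le_trans cm _; have /nondecreasing_seqP h := fun k => shifted_nd k x.
exact: h.
Qed.

Lemma hitting_time_lty c x : (hitting_time c x < +oo)%E <-> exists n, c < L n x.
Proof.
rewrite /hitting_time; case: pselect => [H|H]; last by rewrite ltxx.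
by rewrite ltry.
Qed.

Lemma stopping_hitting_time c : stopping_time Sig (hitting_time c).
Proof.
split=> [x|k k1].
  rewrite /hitting_time; case: pselect => [H|H]; last exact: leey.
  by rewrite lee_fin; lia.
have [n kE] : exists n : nat, k = n%:Z - 1 by exists (absz (k + 1)%R); lia.
have [mk _ _] := Hlam k1.
rewrite (_ : [set x | _] = [set x | c < lam k x]); last first.
  by apply/seteqP; split => x /=; rewrite kE hitting_time_le.
exact: measurable_wrt_gt (sigma_algebra_filtration_ext k) mk.
Qed.

End lambda.

(** Both the truncation and the large part are nondecreasing functions of the value, so [Lambda] is
    preserved; the result will control the remainders. *)
Lemma Lambda_tail lam (b c : R) : 0 <= b -> Lambda Sig lam ->
  Lambda Sig (fun k x => Num.min (lam k x) b + (if c < lam k x then 2 * lam k x else 0)).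
Proof.
move=> b0 Hlam k k1; have [mk k0 knd] := Hlam k k1; split.
- apply: measurable_funD.
    by apply: measurable_minr => //; exact: measurable_cst.
  apply: measurable_fun_ifT.
  + by apply: measurable_fun_ltr => //; exact: measurable_cst.
  + by apply: measurable_funM => //; exact: measurable_cst.
  + exact: measurable_cst.
- move=> x; rewrite addr_ge0//; first by rewrite le_min k0.
  by case: ifP => // _; rewrite mulr_ge0.
- move=> x; have := knd x; have := k0 x; move: (lam k x) (lam (k + 1) x) => u v u0 uv.
  apply: lerD; first by rewrite le_min !ge_min uv lexx orbT.
  case: ltP => h; first by rewrite (lt_le_trans h uv) ler_pM2l.
  by case: ifP => // _; rewrite mulr_ge0// (le_trans u0).
Qed.

Lemma Lambda0 : Lambda Sig (fun _ _ => 0 : R).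
Proof. by move=> k _; split=> //; exact: measurable_cst. Qed.

Lemma lambda_oo0 : lambda_oo (fun (_ : int) (_ : T) => 0 : R) = EFin \o cst 0.
Proof. by apply/funext => x; rewrite /lambda_oo lim_cst. Qed.

End predictable_sequences.

(** * Atomic decomposition *)

Section decomposition_theorem.
Context d (T : measurableType d) (R : realType) (P : probability T R).
Variables (Sig : nat -> set (set T)) (HSig : filtration Sig).
Variables (p : T -> R) (Hp : variable_exponent P p).
Variables (phi : (nat -> R) -> nat -> R) (F : (nat -> T -> R) -> T -> \bar R).

(* [phi] abstracts the functional of the path of the martingale defining the
   quasi-norm: [S_n(f)] for Q, [|f_n|] for D; [F] is its supremum over [n]. *)
Hypothesis phi_rest : forall L : nat -> R, (forall n, 0 <= L n) ->
  (forall n, L n <= L n.+1) -> forall c c' u n, 0 <= c -> c <= c' ->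
  (forall i, (i <= n)%N -> phi u i <= L i) ->
  phi (rest L c c' u) n <= Num.min (L n) c + (if c' < L n then 2 * L n else 0).

Hypothesis phi_jump : forall L : nat -> R, (forall n, 0 <= L n) ->
  (forall n, L n <= L n.+1) -> forall c c' r u n, 0 <= c -> c' = 2 * c -> 0 <= r ->
  (forall i, (i <= n)%N -> phi u i <= L i) ->
  phi (fun n => r * (stopped L c' u n - stopped L c u n)) n <= r * (3 * c).

Hypothesis norm_le_phi : forall u n, `|u n| <= n.+1%:R * phi u n.

Hypothesis F_le : forall M x c, (forall n, phi (M^~ x) n <= c) -> (`|F M x| <= c%:E)%E.

Hypothesis phi_sq : forall M K, martingale P Sig M ->
  (forall n, {ae P, forall x, `|M n x| <= K n}) ->
  forall c, (forall n, {ae P, forall x, phi (M^~ x) n <= c}) ->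
  forall n, expect P (fun x => M n x ^+ 2) <= c ^+ 2.

Let pm := exponent_minus P p.
Let pp := exponent_plus P p.
Let pm0 : 0 < pm := exponent_minus_gt0 Hp.
Let pp0 : 0 < pp := exponent_plus_gt0 Hp.

Let sS n : sigma_algebra setT (Sig n). Proof. by case: HSig. Qed.
Let Sm n : Sig n `<=` measurable. Proof. by case: HSig. Qed.

Definition phi_norm (f : nat -> T -> R) : \bar R :=
  predictable_norm P Sig p (fun n x => phi (f^~ x) n).

Definition controls (lam : int -> T -> R) (f : nat -> T -> R) : Prop :=
  forall n, {ae P, forall x, phi (f^~ x) n <= shifted lam n x}.

Lemma phi_norm_ge0 f : (0 <= phi_norm f)%E.
Proof. by apply: le_ereal_inf_tmp => _ [lam _ <-]; exact: luxnorm_ge0. Qed.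

Lemma phi_norm_le f lam : Lambda Sig lam -> controls lam f ->
  (phi_norm f <= luxnorm P p (lambda_oo lam))%E.
Proof. by move=> Hl Hc; apply: ereal_inf_lbound; exists lam. Qed.

Let luxnorm0 : (luxnorm P p (EFin \o cst 0%R) <= 0)%E.
Proof.
apply/lee_addgt0Pr => e e0; rewrite add0e; apply: luxnorm_EFin_le => //.
under eq_integral do rewrite mul0r powR0 ?gt_eqF ?(let: And4 _ h _ _ := Hp in h _)//.
by rewrite integral0 lee01.
Qed.

(** Take controls whose limits have norm below [1/(j+1)]. The infimum of these limits still
    dominates the path functional and has norm 0, so it vanishes almost everywhere. *)
Lemma phi_norm_eq0_ae f : phi_norm f = 0%E ->
  forall n, {ae P, forall x, phi (f^~ x) n <= 0}.
Proof.
move=> f0 n.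
have /choice[lam Hlam] : forall j : nat, exists lam, [/\ Lambda Sig lam, controls lam f &
    (luxnorm P p (lambda_oo lam) < (j.+1%:R^-1)%:E)%E].
  move=> j; have : (phi_norm f < (j.+1%:R^-1)%:E)%E by rewrite f0 lte_fin invr_gt0.
  by move=> /ereal_inf_lt[_ [l [Hl Hc] <-] h]; exists l.
pose g j := lambda_oo (lam j).
have mg j : measurable_fun setT (g j).
  by have [Hl _ _] := Hlam j; exact: (@measurable_lambda_oo _ _ _ _ HSig _ Hl).
have g0 j x : (0 <= g j x)%E by have [Hl _ _] := Hlam j; exact: lambda_oo_ge0 Hl x.
pose h x := einfs (g^~ x) 0.
have mh : measurable_fun setT h by exact: (measurable_fun_einfs mg 0).
have hg j x : (h x <= g j x)%E by apply: ereal_inf_lbound; exists j.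
have h0 x : (0 <= h x)%E by apply: le_ereal_inf_tmp => _ [j _ <-]; exact: g0.
pose w x := fine (h x).
have mw : measurable_fun setT w by apply: (measurableT_comp _ mh); exact: fine_measurable.
have w0 x : 0 <= w x by exact: fine_ge0.
have wh x : ((w x)%:E <= h x)%E.
  by rewrite /w; move: (h0 x); case: (h x) => [r| |] //= _; rewrite leey.
have lw : (luxnorm P p (EFin \o w) <= 0)%E.
  apply/lee_addgt0Pr => e e0; rewrite add0e.
  pose j := Num.truncn e^-1.
  have [_ _ hj] := Hlam j.
  apply: (@le_trans _ _ (j.+1%:R^-1)%:E); last first.
    by rewrite lee_fin -(invrK e) lef_pV2 ?posrE ?invr_gt0// ltW// truncnS_gt.
  apply: le_trans (ltW hj); apply: (luxnorm_le_ae Hp); [exact/measurable_EFinP|exact: mg|].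
  apply: aeW => x; rewrite !gee0_abs ?lee_fin//; last exact: g0.
  exact: le_trans (wh x) (hg j x).
have wz := luxnorm_le0_ae Hp mw w0 lw.
(* [fine] sends an infinite value to 0, so [w x = 0] says that [h x = 0] only where [h x] is
   finite. *)
have gfin : {ae P, forall x, g 0%N x \is a fin_num}.
  have [_ _ h0'] := Hlam 0%N.
  by apply: (luxnorm_fin_ae Hp (mg 0%N)); rewrite (lt_trans h0')// ltry.
have ctl : {ae P, forall x, forall j, phi (f^~ x) n <= shifted (lam j) n x}.
  by apply: ae_foralln => j; have [_ + _] := Hlam j; apply.
apply: filterS3 wz gfin ctl => x wx gx cx.
have hfin : h x \is a fin_num.
  by rewrite ge0_fin_numE// (le_lt_trans (hg 0%N x))// -ge0_fin_numE.
have hx : h x = 0%E by rewrite -(fineK hfin) -/(w x) wx.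
suff : ((phi (f^~ x) n)%:E <= h x)%E by rewrite hx lee_fin.
apply: le_ereal_inf_tmp => _ [j _ <-].
have [Hl _ _] := Hlam j.
apply: le_trans (shifted_le_oo Hl n x); by rewrite lee_fin cx.
Qed.

(** Doubling leaves room above the infimum only when it is positive; at 0 the zero sequence is a
    control by [phi_norm_eq0_ae]. *)
Lemma near_optimal f : (phi_norm f < +oo)%E -> exists lam,
  [/\ Lambda Sig lam, controls lam f &
      (luxnorm P p (lambda_oo lam) <= 2%:E * phi_norm f)%E].
Proof.
move=> ffin; have [f0|fN0] := eqVneq (phi_norm f) 0%E.
  exists (fun _ _ => 0); split; first exact: Lambda0.
    by move=> n; exact: phi_norm_eq0_ae.
  by rewrite f0 mule0 lambda_oo0.
have ffin' : phi_norm f \is a fin_num by rewrite ge0_fin_numE// phi_norm_ge0.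
have fpos : 0 < fine (phi_norm f).
  by rewrite lt_neqAle fine_ge0 ?phi_norm_ge0// andbT eq_sym fine_eq0.
have : (phi_norm f < 2%:E * phi_norm f)%E.
  by rewrite -(fineK ffin') -EFinM lte_fin; lra.
by move=> /ereal_inf_lt[_ [lam [Hl Hc] <-] /ltW h]; exists lam.
Qed.

Section decomposition.
Variables (f : nat -> T -> R) (Hf : martingale P Sig f).
Variables (lam : int -> T -> R) (Hlam : Lambda Sig lam) (Hctl : controls lam f).
Hypothesis lam_fin : (luxnorm P p (lambda_oo lam) < +oo)%E.

Let L := shifted lam.
Let L0 n x : 0 <= L n x := shifted_ge0 Hlam n x.
Let L_nd n x : L n x <= L n.+1 x := shifted_nd Hlam n x.

Definition finite_limit (x : T) : R := fine (lambda_oo lam x).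
Let G := finite_limit.

Lemma finite_limit_ge0 x : 0 <= G x.
Proof. by apply: fine_ge0; exact: lambda_oo_ge0 Hlam x. Qed.

Lemma measurable_finite_limit : measurable_fun setT G.
Proof.
apply: measurableT_comp; first exact: fine_measurable.
exact: (@measurable_lambda_oo _ _ _ _ HSig _ Hlam).
Qed.

Lemma finite_limitE : {ae P, forall x, lambda_oo lam x = (G x)%:E}.
Proof.
have := luxnorm_fin_ae Hp (@measurable_lambda_oo _ _ _ _ HSig _ Hlam) lam_fin.
by apply: filterS => x hx; rewrite fineK.
Qed.

Lemma shifted_le_limit : {ae P, forall x, forall n, L n x <= G x}.
Proof.
apply: filterS finite_limitE => x hx n.
by rewrite -lee_fin -hx; exact: shifted_le_oo Hlam n x.
Qed.

Lemma luxnorm_finite_limit :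
  luxnorm P p (EFin \o G) = luxnorm P p (lambda_oo lam).
Proof.
have mo := @measurable_lambda_oo _ _ _ _ HSig _ Hlam.
have mG : measurable_fun setT (EFin \o G) by exact/measurable_EFinP/measurable_finite_limit.
by apply: (eq_luxnorm_ae Hp mG mo); apply: filterS finite_limitE => x /= ->.
Qed.

Let beta k := indic_norm P p (level_set G k).
Definition coefficient (k : int) : R := 3 * 2 ^ k * beta k.

Let pow2_gt0 (k : int) : 0 < 2 ^ k :> R. Proof. by rewrite exprz_gt0. Qed.

Lemma coefficient_ge0 k : 0 <= coefficient k.
Proof. by rewrite !mulr_ge0 ?(ltW (pow2_gt0 k))// indic_norm_ge0. Qed.

Definition stop (k : int) (n : nat) (x : T) : R := stopped (L^~ x) (2 ^ k) (f^~ x) n.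

Lemma stop_zpsum j m n x :
  f n x - zpsum (fun k => stop (k + 1) n x - stop k n x) (j, m) =
  rest (L^~ x) (2 ^ (- j%:Z)) (2 ^ (m%:Z + 1)) (f^~ x) n.
Proof.
have tele N : \sum_(i < N) (stop (i%:Z - j%:Z + 1) n x - stop (i%:Z - j%:Z) n x) =
    stop (N%:Z - j%:Z) n x - stop (- j%:Z) n x.
  elim: N => [|N IH]; first by rewrite big_ord0 sub0r subrr.
  rewrite big_ord_recr /= IH (_ : N.+1%:Z - j%:Z = N%:Z - j%:Z + 1); last by lia.
  by ring.
have -> : m%:Z + 1 = (j + m).+1%:Z - j%:Z by lia.
by rewrite /rest /zpsum /= tele /stop; ring.
Qed.

Lemma controls_all : {ae P, forall x, forall n, phi (f^~ x) n <= L n x}.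
Proof. exact: ae_foralln. Qed.

Let pow2S (k : int) : 2 ^ (k + 1) = 2 * 2 ^ k :> R.
Proof. by rewrite expfzDr// expr1z mulrC. Qed.

Lemma luxnorm_hitting k : luxnorm P p
    (EFin \o \1_[set x | (hitting_time lam (2 ^ k) x < +oo)%E]) = (beta k)%:E.
Proof.
set A := [set x | _].
have AE : A = \bigcup_n [set x | 2 ^ k < L n x].
  by apply/seteqP; split => x => [/hitting_time_lty[n]|[n _ h]]; [exists n|apply/hitting_time_lty; exists n].
have mA : measurable A.
  rewrite AE; apply: bigcupT_measurable => n; apply: (Sm (n := n.-1)).
  exact: measurable_wrt_gt (sS _) (@measurable_wrt_shifted _ _ _ _ HSig _ Hlam n).
have mB : measurable (level_set G k) := measurable_level_set measurable_finite_limit k.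
have AB : {ae P, forall x, \1_A x = \1_(level_set G k) x :> R}.
  apply: filterS2 finite_limitE shifted_le_limit => x Gx LG.
  rewrite !indicE; congr (_%:R); congr (nat_of_bool _); apply/idP/idP; rewrite !inE.
    by rewrite AE => -[n _ /= h]; exact: lt_le_trans h (LG n).
  move=> /= h; rewrite AE; apply: contrapT => noL.
  move: h; apply/negP; rewrite -leNgt -lee_fin -Gx.
  apply: (lambda_oo_le Hlam) => n; rewrite lee_fin leNgt; apply/negP => h.
  by apply: noL; exists n.
rewrite -(indic_normE Hp mB).
have m1 : measurable_fun setT (EFin \o \1_A : T -> \bar R).
  by apply/measurable_EFinP; exact: measurable_indic.
have m2 : measurable_fun setT (EFin \o \1_(level_set G k) : T -> \bar R).
  by apply/measurable_EFinP; exact: measurable_indic.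
by apply: (eq_luxnorm_ae Hp m1 m2); apply: filterS AB => x /= ->.
Qed.

(** An indicator of norm 0 means a null level set, so [G <= 2^k] almost everywhere and neither
    stopping takes place. This settles the levels whose coefficient cannot be inverted. *)
Lemma stop_jump_eq0 k : beta k = 0 ->
  {ae P, forall x, forall n, stop (k + 1) n x - stop k n x = 0}.
Proof.
move=> b0; have mB := measurable_level_set measurable_finite_limit k.
have : {ae P, forall x, \1_(level_set G k) x = 0 :> R}.
  have mI : measurable_fun setT (\1_(level_set G k) : T -> R) by exact: measurable_indic.
  have I0 x : 0 <= \1_(level_set G k) x :> R by rewrite indicE ler0n.
  apply: (luxnorm_le0_ae Hp mI I0).
  by rewrite (indic_normE Hp mB) -/(beta k) b0.
apply: filterS2 shifted_le_limit => x LG + n.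
rewrite indicE => /eqP; rewrite pnatr_eq0 eqb0 => /negP xB.
have Lk : L n x <= 2 ^ k.
  by apply: le_trans (LG n) _; rewrite leNgt; apply/negP => h; apply: xB; rewrite inE.
rewrite /stop !stopped_id ?subrr//.
by apply: le_trans Lk _; rewrite pow2S; have := pow2_gt0 k; lra.
Qed.

(** Up to and including the hitting time [L n <= 2^k], so both stopped values are still [f n]; this
    is the vanishing condition on atoms. *)
Lemma stop_jump_before k x n : (n%:Z%:E <= hitting_time lam (2 ^ k) x)%E ->
  stop (k + 1) n x - stop k n x = 0.
Proof.
move=> nt; have Ln : L n x <= 2 ^ k.
  rewrite leNgt -(hitting_time_le Hlam); apply/negP => tn.
  by have := le_trans nt tn; rewrite lee_fin; lia.
rewrite /stop !stopped_id ?subrr//.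
by apply: le_trans Ln _; rewrite pow2S; have := pow2_gt0 k; lra.
Qed.

Lemma stop_jump_phi k (r : R) : 0 <= r -> {ae P, forall x, forall n,
  phi (fun n => r * (stop (k + 1) n x - stop k n x)) n <= r * (3 * 2 ^ k)}.
Proof.
move=> r0; apply: filterS controls_all => x ctl n.
exact: (phi_jump (L0^~ x) (L_nd^~ x) (ltW (pow2_gt0 k)) (pow2S k) r0 (fun i _ => ctl i)).
Qed.

Let atomP := atom_for P F Sig p.

(** [r] will be the inverse of the coefficient, or 0 for a null level set, so that one argument
    covers both. *)
Lemma atom_of_condexp (a : T -> R) k (M : nat -> T -> R) (r : R) :
  0 <= r -> intg P a -> (forall n, is_condexp P (Sig n) a (M n)) ->
  (forall n, {ae P, forall x, M n x = r * (stop (k + 1) n x - stop k n x)}) ->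
  ((r * (3 * 2 ^ k))%:E <= (beta k)%:E^-1)%E ->
  atomP a.
Proof.
move=> r0 ia ca Mr hr; split => //; exists (hitting_time lam (2 ^ k)).
have aM : {ae P, forall x, forall n,
    condexp P (Sig n) a x = r * (stop (k + 1) n x - stop k n x)}.
  apply: ae_foralln => n.
  by apply: filterS2 (condexp_ae_eq (sS n) (@Sm n) (ca n)) (Mr n) => x -> ->.
split.
- exact: (@stopping_hitting_time _ _ _ _ HSig _ Hlam).
- move=> n; apply: filterS aM => x aM nt.
  by rewrite aM stop_jump_before ?mulr0.
- rewrite luxnorm_hitting; apply: le_trans hr.
  rewrite Lnorm.unlock; have -> : (0 < P setT)%E by rewrite probability_setT.
  apply/ess_supP; apply: filterS2 aM (stop_jump_phi k r0) => x aM h /=.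
  apply: F_le => n; rewrite /martingale_of.
  by rewrite (funext aM : (fun n => condexp P (Sig n) a x) = _); exact: h.
Qed.

Lemma atom_exists k : exists a : T -> R, atomP a /\
  {ae P, forall x, forall n,
     coefficient k * condexp P (Sig n) a x = stop (k + 1) n x - stop k n x}.
Proof.
have mart j : martingale P Sig (stop j).
  by apply: martingale_stopped => // n; exact: @measurable_wrt_shifted _ _ _ _ HSig _ Hlam n.
(* A null level set gets the zero atom: its coefficient is 0, the jump vanishes, and the size
   condition is void because the inverse of 0 is [+oo]. *)
have [b0|bN0] := eqVneq (beta k) 0.
  have c0 n : is_condexp P (Sig n) (cst 0) (cst 0 : T -> R).
    by split=> //; [exact: measurable_cst|exact: intg_cst].
  exists (cst 0); split.
    apply: (@atom_of_condexp _ k (fun _ => cst 0) 0) => //; first exact: intg_cst.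
      by move=> n; apply: aeW => x; rewrite mul0r.
    by rewrite b0 inve0 leey.
  have cE : {ae P, forall x, forall n, condexp P (Sig n) (cst 0) x = 0 :> R}.
    by apply: ae_foralln => n; exact: condexp_ae_eq (sS n) (@Sm n) (c0 n).
  by apply: filterS2 cE (stop_jump_eq0 b0) => x cx h n; rewrite cx mulr0 h.
have b_gt0 : 0 < beta k by rewrite lt_neqAle eq_sym bN0 indic_norm_ge0.
have t_gt0 : 0 < coefficient k by rewrite !mulr_gt0// pow2_gt0.
pose r := (coefficient k)^-1.
have r0 : 0 <= r by rewrite invr_ge0 ltW.
pose M n x := r * (stop (k + 1) n x - stop k n x).
have mM : martingale P Sig M by apply: martingaleZ => //; exact: martingaleB.
have rE : r * (3 * 2 ^ k) = (beta k)^-1.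
  by rewrite /r /coefficient; field; rewrite bN0 gt_eqF// pow2_gt0.
have Mphi n : {ae P, forall x, phi (M^~ x) n <= (beta k)^-1}.
  by apply: filterS (stop_jump_phi k r0) => x; rewrite rE; apply.
(* A bound depending on [n] is enough to make products integrable; the uniform L^2 bound comes from
   [phi_sq]. *)
have MK n : {ae P, forall x, `|M n x| <= n.+1%:R * (beta k)^-1}.
  apply: filterS (Mphi n) => x h; apply: le_trans (norm_le_phi (M^~ x) n) _.
  by rewrite ler_pM2l// ltr0n.
have [a ia ca] := L2_bounded_martingale_closed HSig mM MK (phi_sq mM MK Mphi).
exists a; split.
  apply: (@atom_of_condexp a k M r) => //; first by move=> n; exact: aeW.
  by rewrite rE inver (negbTE bN0).
apply: ae_foralln => n.
apply: filterS (condexp_ae_eq (sS n) (@Sm n) (ca n)) => x ->.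
by rewrite /M mulrA mulfV ?mul1r// gt_eqF.
Qed.

Section with_atoms.
Variable a : int -> T -> R.
Hypothesis Ha : forall k, {ae P, forall x, forall n,
  coefficient k * condexp P (Sig n) (a k) x = stop (k + 1) n x - stop k n x}.

Lemma ae_forall_int (Q : int -> T -> Prop) : (forall k, {ae P, forall x, Q k x}) ->
  {ae P, forall x, forall k, Q k x}.
Proof.
move=> HQ.
have h1 : {ae P, forall x, forall n, Q (Posz n) x} by exact: ae_foralln.
have h2 : {ae P, forall x, forall n, Q (Negz n) x} by exact: ae_foralln.
by apply: filterS2 h1 h2 => x h1 h2 [].
Qed.

Let remainder jm n x :=
  f n x - zpsum (fun k => coefficient k * condexp P (Sig n) (a k) x) jm.

Lemma remainder_rest : {ae P, forall x, forall jm n,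
  remainder jm n x =
  rest (L^~ x) (2 ^ (- jm.1%:Z)) (2 ^ (jm.2%:Z + 1)) (f^~ x) n}.
Proof.
apply: filterS (ae_forall_int Ha) => x hx [j m] n.
rewrite /remainder -stop_zpsum; congr (_ - _).
by apply: eq_bigr => i _; rewrite hx.
Qed.

Lemma phi_remainder : {ae P, forall x, forall jm n,
  phi (remainder jm ^~ x) n <=
  Num.min (L n x) (2 ^ (- jm.1%:Z)) +
    (if 2 ^ (jm.2%:Z + 1) < L n x then 2 * L n x else 0)}.
Proof.
apply: filterS2 remainder_rest controls_all => x hx ctl [j m] n /=.
have -> : remainder (j, m) ^~ x = rest (L^~ x) (2 ^ (- j%:Z)) (2 ^ (m%:Z + 1)) (f^~ x).
  by apply/funext => i; exact: hx.
have le_pow : 2 ^ (- j%:Z) <= 2 ^ (m%:Z + 1) :> R by rewrite ler_eXz2l ?ltr1n//; lia.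
exact: (phi_rest (L0^~ x) (L_nd^~ x) (ltW (pow2_gt0 _)) le_pow (fun i _ => ctl i)).
Qed.

(** Widening the window on either side lowers the bound, so one symmetric tail handles the double
    limit. *)
Lemma tail_bound (y : R) N jm : 0 <= y -> (N <= jm.1)%N -> (N <= jm.2)%N ->
  Num.min y (2 ^ (- jm.1%:Z)) + (if 2 ^ (jm.2%:Z + 1) < y then 2 * y else 0) <=
  tail id N y.
Proof.
move=> y0 N1 N2; rewrite /tail /=; apply: lerD.
  rewrite le_min !ge_min lexx /=; apply/orP; right.
  by rewrite exprnN ler_eXz2l ?ltr1n//; lia.
case: ltP => h1; last by case: ifP => // _; rewrite mulr_ge0.
rewrite ifT//; apply: le_lt_trans h1.
by rewrite exprnP ler_eXz2l ?ltr1n//; lia.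
Qed.

(** At fixed [n] and [x] a wide enough window passes the number [L n x] above and truncates it below
    the accuracy; the factor of [norm_le_phi] is divided out beforehand. *)
Lemma cvg_zpsum n : {ae P, forall x,
  zpsum (fun k => coefficient k * condexp P (Sig n) (a k) x) jm
    @[jm --> (\oo, \oo)] --> f n x}.
Proof.
apply: filterS phi_remainder => x hx; apply/cvgrPdist_le => /= e e0.
have e0' : 0 < e / n.+1%:R by rewrite divr_gt0// ltr0n.
have [N HN] := tail_small (@id R) (L n x) e0'.
exists ([set k | (N <= k)%N], [set k | (N <= k)%N]) => /=.
  by split; exists N.
move=> [j m] /= [Nj Nm].
apply: le_trans (norm_le_phi (remainder (j, m) ^~ x) n) _.
rewrite mulrC -ler_pdivlMr ?ltr0n//; apply: le_trans (hx _ _) _.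
by apply: le_trans (tail_bound (N := N) _ _ _) (HN N (leqnn N)).
Qed.

(** The sequence of [Lambda_tail] controls the remainder, and its limit is at most [tail G N] almost
    everywhere, which [luxnorm_tail_small] makes small. *)
Lemma cvg_phi_norm_remainder :
  phi_norm (remainder jm) @[jm --> (\oo, \oo)] --> 0%E.
Proof.
have small (e : R) : 0 < e -> exists N, forall jm, (N <= jm.1)%N -> (N <= jm.2)%N ->
    (phi_norm (remainder jm) <= e%:E)%E.
  move=> e0; have mG := measurable_finite_limit; have G0 := finite_limit_ge0.
  have Gfin : (luxnorm P p (EFin \o G) < +oo)%E by rewrite luxnorm_finite_limit.
  have [N HN] := luxnorm_tail_small Hp mG G0 Gfin e0.
  exists N => -[j m] /= Nj Nm; apply: le_trans HN.
  have Hl := Lambda_tail (2 ^ (m%:Z + 1)) (ltW (pow2_gt0 (- j%:Z))) Hlam.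
  apply: le_trans (phi_norm_le Hl _) _.
    by move=> n; apply: filterS phi_remainder => x; exact.
  apply: (luxnorm_le_ae Hp).
  - exact: (@measurable_lambda_oo _ _ _ _ HSig _ Hl).
  - by apply/measurable_EFinP; exact: measurable_tail.
  apply: filterS shifted_le_limit => x LG.
  rewrite !gee0_abs; [|by rewrite lee_fin tail_ge0|exact: lambda_oo_ge0 Hl x].
  apply: (lambda_oo_le Hl) => n; rewrite lee_fin.
  apply: le_trans (tail_bound (N := N) (jm := (j, m)) (L0 n x) Nj Nm) _.
  rewrite /tail /=; apply: lerD; first by rewrite le_min !ge_min LG lexx orbT.
  case: ltP => h; first by rewrite (lt_le_trans h (LG n)) ler_pM2l.
  by case: ifP => // _; rewrite mulr_ge0.
have near_small (e : R) : 0 < e ->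
    \forall jm \near (\oo, \oo), (phi_norm (remainder jm) <= e%:E)%E.
  move=> e0; have [N HN] := small e e0.
  exists ([set k | (N <= k)%N], [set k | (N <= k)%N]) => /=; first by split; exists N.
  by move=> [j m] /= [Nj Nm]; exact: HN.
apply/fine_cvgP; split.
  apply: filterS (near_small 1 ltr01) => jm h.
  by rewrite ge0_fin_numE ?phi_norm_ge0// (le_lt_trans h)// ltry.
apply/cvgrPdist_le => /= e e0; apply: filterS (near_small e e0) => jm h.
rewrite sub0r normrN ger0_norm; last by rewrite fine_ge0 ?phi_norm_ge0.
by rewrite -lee_fin fineK// ge0_fin_numE ?phi_norm_ge0// (le_lt_trans h)// ltry.
Qed.

End with_atoms.

Lemma zpsum_coefficient (q : R) N : 0 < q ->
  zpsum (fun k => coefficient k `^ q) (N, N) =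
  3 `^ q * zpsum (fun k => (2 ^ k * beta k) `^ q) (N, N).
Proof.
move=> q0; rewrite -zpsum_scale; apply: eq_bigr => i _.
by rewrite /coefficient -mulrA powRM// mulr_ge0 ?(ltW (pow2_gt0 _))// indic_norm_ge0.
Qed.

Lemma esum_coefficient_le (v : R) : 0 <= v -> (luxnorm P p (EFin \o G) <= v%:E)%E ->
  ((\esum_(k in [set: int]) (coefficient k `^ pp)%:E) `^ pp^-1 <=
   (3 * level_constant P p * v)%:E)%E.
Proof.
move=> v0 hv; have K0 := level_constant_gt0 Hp; set K := level_constant P p in K0 *.
apply/lee_addgt0Pr => e e0.
(* Strictly above [v], so that the modular at scale [s] is at most 1; the excess becomes exactly [e]
   after multiplication by [3 * K]. *)
pose s := v + e / (3 * K).
have s0 : 0 < s by rewrite ltr_wpDl// divr_gt0// mulr_gt0.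
have -> : ((3 * K * v)%:E + e%:E = (3 * (s * K))%:E)%E.
  by rewrite -EFinD /s; congr EFin; field; rewrite gt_eqF.
have c0 : 0 <= 3 * (s * K) by rewrite !mulr_ge0 ?(ltW s0) ?(ltW K0).
have hs : (luxnorm P p (EFin \o G) < s%:E)%E.
  by rewrite (le_lt_trans hv)// lte_fin ltrDl divr_gt0// mulr_gt0.
have hI := luxnorm_EFin_lt Hp measurable_finite_limit finite_limit_ge0 s0 hs.
have : (\esum_(k in [set: int]) (coefficient k `^ pp)%:E <=
    ((3 * (s * K)) `^ pp)%:E)%E.
  apply/esum_zpsum_le => [k|N]; first exact: powR_ge0.
  rewrite zpsum_coefficient// powRM ?mulr_ge0 ?(ltW s0) ?(ltW K0)// ler_wpM2l ?powR_ge0//.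
  exact: (level_sum_le Hp measurable_finite_limit finite_limit_ge0).
have : (0 <= \esum_(k in [set: int]) (coefficient k `^ pp)%:E)%E.
  by apply: esum_ge0 => k _; rewrite lee_fin powR_ge0.
move: (esum _ _) => [r| |]//= r0; rewrite !lee_fin => h.
by apply: powR_Vle.
Qed.

(** No constant appears because the 3 in the coefficients absorbs the factor 2 of
    [le_level_luxnorm]. *)
Lemma luxnorm_le_esum_coefficient : (luxnorm P p (EFin \o G) <=
  (\esum_(k in [set: int]) (coefficient k `^ pm)%:E) `^ pm^-1)%E.
Proof.
have := @esum_zpsum_le _ (fun k => coefficient k `^ pm).
have : (0 <= \esum_(k in [set: int]) (coefficient k `^ pm)%:E)%E.
  by apply: esum_ge0 => k _; rewrite lee_fin powR_ge0.
move: (esum _ _) => [r| |]//= r0 hr; last by rewrite gt_eqF ?invr_gt0// leey.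
have t0 : 0 <= r `^ pm^-1 by exact: powR_ge0.
have zr N : zpsum (fun k => coefficient k `^ pm) (N, N) <= r.
  exact: (hr r (fun k => powR_ge0 _ _)).1 (lexx _) N.
have h N : zpsum (fun k => (2 ^ k * beta k) `^ pm) (N, N) <= (r `^ pm^-1 / 3) `^ pm.
  have -> : (r `^ pm^-1 / 3) `^ pm = (3 `^ pm)^-1 * r.
    by rewrite mulrC powRM// powRV// -powRrM mulVf ?gt_eqF// powRr1.
  by rewrite ler_pdivlMl ?powR_gt0// -zpsum_coefficient.
have t30 : 0 <= r `^ pm^-1 / 3 by rewrite divr_ge0.
apply: le_trans (le_level_luxnorm Hp measurable_finite_limit finite_limit_ge0 t30 h) _.
by rewrite lee_fin; lra.
Qed.

End decomposition.

Theorem atomic_decomposition : exists2 C : R, 0 < C &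
  forall f : nat -> T -> R, martingale P Sig f -> (phi_norm f < +oo)%E ->
  exists (a : int -> T -> R) (theta : int -> R),
    [/\ (forall k, atom_for P F Sig p (a k)) /\ (forall k, 0 <= theta k),
        (forall n, {ae P, forall x,
           zpsum (fun k => theta k * condexp P (Sig n) (a k) x) jm
             @[jm --> (\oo, \oo)] --> f n x}),
        ((C^-1)%:E * (\esum_(k in [set: int]) (theta k `^ pp)%:E) `^ pp^-1
           <= phi_norm f)%E /\
        (phi_norm f <=
           C%:E * (\esum_(k in [set: int]) (theta k `^ pm)%:E) `^ pm^-1)%E &
        phi_norm (fun n x => f n x
              - zpsum (fun k => theta k * condexp P (Sig n) (a k) x) jm)
            @[jm --> (\oo, \oo)] --> 0%E].
Proof.
have K0 := level_constant_gt0 Hp.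
(* The 6 is the 3 of the coefficients times the 2 of [near_optimal]; the added 1 gives [C >= 1],
   which the upper bound uses. *)
pose C := 6 * level_constant P p + 1.
have C0 : 0 < C by rewrite addr_gt0// mulr_gt0.
have C1 : 1 <= C by rewrite lerDr mulr_ge0// ltW.
exists C => // f Hf ffin.
have [lam [Hlam Hctl hlam]] := near_optimal ffin.
have ffin' : phi_norm f \is a fin_num by rewrite ge0_fin_numE// phi_norm_ge0.
have lam_fin : (luxnorm P p (lambda_oo lam) < +oo)%E.
  by apply: le_lt_trans hlam _; rewrite -(fineK ffin') -EFinM ltry.
have /choice[a Ha] := atom_exists Hf Hlam Hctl lam_fin.
have Ha' k := (Ha k).2.
exists a, (coefficient lam); split.
- by split=> k; [exact: (Ha k).1|exact: coefficient_ge0].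
- by move=> n; exact: (cvg_zpsum Hlam Hctl lam_fin Ha').
- split.
    rewrite lee_pdivrMl//; set v := fine (phi_norm f).
    have v0 : 0 <= v by rewrite fine_ge0 ?phi_norm_ge0.
    rewrite -(fineK ffin') -/v -EFinM.
    have v20 : 0 <= 2 * v by rewrite mulr_ge0.
    apply: le_trans (esum_coefficient_le Hlam v20 _) _.
      by rewrite (luxnorm_finite_limit Hlam lam_fin) EFinM fineK.
    by rewrite lee_fin /C; nra.
  apply: le_trans (phi_norm_le Hlam Hctl) _.
  rewrite -(luxnorm_finite_limit Hlam lam_fin).
  apply: le_trans (luxnorm_le_esum_coefficient Hlam) _.
  by rewrite -[leLHS]mul1e lee_wpmul2r ?poweR_ge0// lee_fin.
- exact: (cvg_phi_norm_remainder Hlam Hctl lam_fin Ha').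
Qed.

End decomposition_theorem.

(** * The quasi-norms Q and D *)

Section quasi_norms.
Context d (T : measurableType d) (R : realType) (P : probability T R).
Variables (Sig : nat -> set (set T)) (HSig : filtration Sig).

Lemma square_function_le (M : nat -> T -> R) (x : T) (c : R) :
  (forall n, sq_upto (M^~ x) n <= c) -> (`|square_function M x| <= c%:E)%E.
Proof.
move=> hc; pose u n : \bar R := (sq_upto (M^~ x) n)%:E.
have u0 n : (0 <= u n)%E by rewrite lee_fin sqrtr_ge0.
have ucvg : cvgn u.
  apply: ereal_nondecreasing_is_cvgn; apply/nondecreasing_seqP => n.
  rewrite lee_fin ler_sqrt; last by apply: sumr_ge0 => i _; exact: sqr_ge0.
  by rewrite [leRHS]big_ord_recr /= lerDl sqr_ge0.
have -> : square_function M x = limn u by [].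
rewrite gee0_abs; last by apply: lime_ge => //; exact: nearW.
by apply: lime_le => //; apply: nearW => n; rewrite lee_fin.
Qed.

Lemma maximal_function_le (M : nat -> T -> R) (x : T) (c : R) :
  (forall n, abs_at (M^~ x) n <= c) -> (`|maximal_function M x| <= c%:E)%E.
Proof.
move=> hc; rewrite gee0_abs.
  by apply: ge_ereal_sup => _ [n _ <-]; rewrite lee_fin; exact: hc.
by apply: ereal_sup_ge; exists `|M 0%N x|%:E; [exists 0%N|rewrite lee_fin].
Qed.

Section bounded.
Variables (M : nat -> T -> R) (K : nat -> R).
Hypotheses (HM : martingale P Sig M)
  (MK : forall n, {ae P, forall x, `|M n x| <= K n}).

Lemma expect_sq_le_sq_upto (c : R) :
  (forall n, {ae P, forall x, sq_upto (M^~ x) n <= c}) ->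
  forall n, expect P (fun x => M n x ^+ 2) <= c ^+ 2.
Proof.
move=> hc n; rewrite -(expect_sum_sq HSig HM MK) -[leRHS](@expect_cst _ _ _ P).
apply: le_expect.
- exact: (intg_sum n.+1 (intg_increment_sq HSig HM MK)).
- exact: intg_cst.
- apply: filterS (hc n) => x h.
  by rewrite -sq_upto_le// (le_trans _ h)// sqrtr_ge0.
Qed.

Lemma expect_sq_le_abs_at (c : R) :
  (forall n, {ae P, forall x, abs_at (M^~ x) n <= c}) ->
  forall n, expect P (fun x => M n x ^+ 2) <= c ^+ 2.
Proof.
move=> hc n; rewrite -[leRHS](@expect_cst _ _ _ P).
apply: le_expect; [exact: (intg_sq HSig HM MK)|exact: intg_cst|].
apply: filterS (hc n) => x; rewrite /abs_at => h.
by rewrite -[leLHS]real_normK ?num_real// lerXn2r ?nnegrE// (le_trans _ h).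
Qed.

End bounded.
End quasi_norms.

Theorem theorem3p2 (R : realType) (d : measure_display) (T : measurableType d)
    (P : probability T R) (Pcomplete : measure_is_complete P)
    (Sig : nat -> set (set T)) (HSig : filtration Sig)
    (p : T -> R) (Hp : variable_exponent P p) :
  (exists2 C : R, 0 < C &
    forall f : nat -> T -> R, Qspace P Sig p f ->
    exists (a : int -> T -> R) (theta : int -> R),
      [/\ (forall k, A2_atom P Sig p (a k)) /\ (forall k, 0 <= theta k),
          (forall n, {ae P, forall x,
             zpsum (fun k => theta k * condexp P (Sig n) (a k) x) jm
               @[jm --> (\oo, \oo)] --> f n x}),
          ((C^-1)%:E * (\esum_(k in [set: int]) (theta k `^ exponent_plus P p)%:E)
               `^ (exponent_plus P p)^-1 <= Qnorm P Sig p f)%E /\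
          (Qnorm P Sig p f <=
             C%:E * (\esum_(k in [set: int]) (theta k `^ exponent_minus P p)%:E)
               `^ (exponent_minus P p)^-1)%E &
          forall eta : R, aoki_rolewicz_exponent P p eta ->
            exponent_plus P p <= eta ->
            Qnorm P Sig p (fun n x => f n x
                - zpsum (fun k => theta k * condexp P (Sig n) (a k) x) jm)
              @[jm --> (\oo, \oo)] --> 0%E]) /\
  (exists2 C : R, 0 < C &
    forall f : nat -> T -> R, Dspace P Sig p f ->
    exists (a : int -> T -> R) (theta : int -> R),
      [/\ (forall k, A3_atom P Sig p (a k)) /\ (forall k, 0 <= theta k),
          (forall n, {ae P, forall x,
             zpsum (fun k => theta k * condexp P (Sig n) (a k) x) jm
               @[jm --> (\oo, \oo)] --> f n x}),
          ((C^-1)%:E * (\esum_(k in [set: int]) (theta k `^ exponent_plus P p)%:E)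
               `^ (exponent_plus P p)^-1 <= Dnorm P Sig p f)%E /\
          (Dnorm P Sig p f <=
             C%:E * (\esum_(k in [set: int]) (theta k `^ exponent_minus P p)%:E)
               `^ (exponent_minus P p)^-1)%E &
          forall eta : R, aoki_rolewicz_exponent P p eta ->
            exponent_plus P p <= eta ->
            Dnorm P Sig p (fun n x => f n x
                - zpsum (fun k => theta k * condexp P (Sig n) (a k) x) jm)
              @[jm --> (\oo, \oo)] --> 0%E]).
Proof.
split.
(* With [phi] instantiated to [sq_upto], [phi_norm] is convertible to [Qnorm]. *)
- have [C C0 HC] := atomic_decomposition HSig Hp (@sq_rest_le R) (@sq_jump_le R)
    (@norm_le_sq_upto R) (@square_function_le _ T R)
    (fun M K HM MK => expect_sq_le_sq_upto HSig HM MK).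
  exists C => // f [mf ff]; have [a [theta [h1 h2 h3 h4]]] := HC f mf ff.
  by exists a, theta; split.
- have [C C0 HC] := atomic_decomposition HSig Hp (@abs_rest_le R) (@abs_jump_le R)
    (@norm_le_abs_at R) (@maximal_function_le _ T R)
    (fun M K HM MK => expect_sq_le_abs_at HSig HM MK).
  exists C => // f [mf ff]; have [a [theta [h1 h2 h3 h4]]] := HC f mf ff.
  by exists a, theta; split.
Qed.
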